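(* For every $n\ge 2$, the tropical Pollaczek-Geiringer variety $\mathrm{trop}(\mathrm{CM}_n^2)$, viewed in tropical projective space $\mathbb{R}^{\binom{[n]}{2}}/\mathbb{R}(1,\dots,1)^T$, admits a simplicial fan structure isomorphic to the tree pair complex $\mathrm{TP}(n)$.
   Context: Coordinates of $\mathbb{R}^{\binom{[n]}{2}}$ are indexed by pairs $uv$, $u<v$ in $[n]$. The Cayley-Menger variety $\mathrm{CM}_n^d\subseteq\mathbb{C}^{\binom{[n]}{2}}$ is the Zariski closure of $\{(\|p_u-p_v\|^2)_{u<v}: p_1,\dots,p_n\in\mathbb{R}^d\}$; $\mathrm{CM}_n^2$ is the Pollaczek-Geiringer variety. Tropicalization (max convention): over the Puiseux series field $K=\mathbb{C}\{\!\{t\}\!\}$ with $\mathrm{val}(a)=-(\text{smallest exponent of }t\text{ in }a)$, $\mathrm{trop}(X)$ for $X\subseteq\mathbb{C}^S$ with ideal $I$ is the Euclidean closure of $\{(\mathrm{val}(x_i))_i: x\in V_K(I)\}\cap\mathbb{R}^S$. The set $\mathrm{trop}(\mathrm{CM}_n^2)$ is invariant under adding real multiples of $(1,\dots,1)^T$, so it may be considered in the quotient $\mathbb{R}^{\binom{[n]}{2}}/\mathbb{R}(1,\dots,1)^T$. A rooted tree on leaf set $[n]$ is a rooted tree whose leaves are labeled bijectively by $[n]$ and whose internal vertices each have at least two children. A clade of such a tree $T$ is the set of leaves below some internal vertex; $\mathrm{clade}(T)$ is the set of all clades of $T$ (it always contains $[n]$, the clade of the root). The tree pair complex $\mathrm{TP}(n)$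 is the abstract simplicial complex on ground set $2^{[n]}$ whose faces are all sets of the form $\mathrm{clade}(T_1)\cup\mathrm{clade}(T_2)$ for rooted trees $T_1,T_2$ on leaf set $[n]$. *)

(* Defs.v *)
From HB Require Import structures.
From mathcomp Require Import all_boot all_algebra.
From mathcomp Require Import boolp Rstruct.
From mathcomp.real_closed Require Import complex.
From mathcomp Require Import fraction.
From mathcomp Require mpoly.
Set Implicit Arguments. Unset Strict Implicit. Unset Printing Implicit Defensive.
Import GRing.Theory Num.Theory.
Local Open Scope ring_scope.

Section FPS.
Variable F : fieldType.

Record fps := FPS { fcoef : nat -> F }.

HB.instance Definition _ := gen_eqMixin fps.
HB.instance Definition _ := gen_choiceMixin fps.

Lemma fpsP (a b : fps) : (forall k, fcoef a k = fcoef b k) -> a = b.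
Proof. by case: a; case: b => fa fb /= H; congr FPS; apply: funext. Qed.

Definition fps0 := FPS (fun _ => 0).
Definition fpsN a := FPS (fun k => - fcoef a k).
Definition fpsD a b := FPS (fun k => fcoef a k + fcoef b k).

Fact fpsDA : associative fpsD. Proof. by move=> a b c; apply: fpsP => k /=; rewrite addrA. Qed.
Fact fpsDC : commutative fpsD. Proof. by move=> a b; apply: fpsP => k /=; rewrite addrC. Qed.
Fact fps0D : left_id fps0 fpsD. Proof. by move=> a; apply: fpsP => k /=; rewrite add0r. Qed.
Fact fpsND : left_inverse fps0 fpsN fpsD. Proof. by move=> a; apply: fpsP => k /=; rewrite addNr. Qed.

HB.instance Definition _ := GRing.isZmodule.Build fps fpsDA fpsDC fps0D fpsND.

Definition fps1 := FPS (fun k => (k == 0%N)%:R).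
Definition fpsM a b := FPS (fun k => \sum_(j < k.+1) fcoef a j * fcoef b (k - j)).

Lemma coef_fpsM a b k :
  fcoef (fpsM a b) k = \sum_(j < k.+1) fcoef a j * fcoef b (k - j).
Proof. by []. Qed.

Lemma fpsM_rev a b k :
  fcoef (fpsM a b) k = \sum_(j < k.+1) fcoef a (k - j) * fcoef b j.
Proof.
rewrite coef_fpsM (reindex_inj rev_ord_inj) /=.
by apply: eq_bigr => j _; rewrite (sub_ordK j).
Qed.

Fact fpsMA : associative fpsM.
Proof.
move=> p q r; apply: fpsP => i; rewrite coef_fpsM -/(fpsM p (fpsM q r)) fpsM_rev.
pose coef3 j k := fcoef p j * (fcoef q (i - j - k)%N * fcoef r k).
transitivity (\sum_(j < i.+1) \sum_(k < i.+1 | (k <= i - j)%N) coef3 j k).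
  apply: eq_bigr => j _; rewrite fpsM_rev big_distrr /=.
  by rewrite (big_ord_narrow_leq (leq_subr _ _)).
rewrite (exchange_big_dep predT) //=; apply: eq_bigr => k _.
transitivity (\sum_(j < i.+1 | (j <= i - k)%N) coef3 j k).
  apply: eq_bigl => j; rewrite -ltnS -(ltnS j) -!subSn ?leq_ord //.
  by rewrite -subn_gt0 -(subn_gt0 j) -!subnDA addnC.
rewrite (big_ord_narrow_leq (leq_subr _ _)) big_distrl /=.
by apply: eq_bigr => j _; rewrite /coef3 -!subnDA addnC mulrA.
Qed.

Fact fpsMC : commutative fpsM.
Proof.
move=> a b; apply: fpsP => k; rewrite [RHS]fpsM_rev /=.
by apply: eq_bigr => j _; rewrite mulrC.
Qed.

Fact fps1M : left_id fps1 fpsM.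
Proof.
move=> a; apply: fpsP => k /=; rewrite big_ord_recl /= mul1r subn0 big1 ?addr0 //.
by move=> j _; rewrite mul0r.
Qed.

Fact fpsMDl : left_distributive fpsM fpsD.
Proof.
move=> a b c; apply: fpsP => k /=; rewrite -big_split /=.
by apply: eq_bigr => j _; rewrite mulrDl.
Qed.

Fact fps1_neq0 : fps1 != fps0.
Proof. by apply/eqP => /(congr1 (fcoef^~ 0%N)) /= /eqP; rewrite oner_eq0. Qed.

HB.instance Definition _ := GRing.Zmodule_isComNzRing.Build fps fpsMA fpsMC fps1M fpsMDl fps1_neq0.

Definition fps_unit : {pred fps} := fun x => `[< exists y : fps, y * x = 1 >].
Definition fps_inv (x : fps) : fps :=
  match pselect (exists y : fps, y * x = 1) with
  | left H => projT1 (cid H)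
  | right _ => x
  end.

Fact fps_mulVx : {in fps_unit, left_inverse 1 fps_inv *%R}.
Proof.
move=> x /asboolP Hx; rewrite /fps_inv; case: pselect => // H.
by case: (cid H).
Qed.

Fact fps_unitPl (x y : fps) : y * x = 1 -> fps_unit x.
Proof. by move=> H; apply/asboolP; exists y. Qed.

Fact fps_invr_out : {in [predC fps_unit], fps_inv =1 id}.
Proof.
move=> x; rewrite inE /= => /asboolPn Hx; rewrite /fps_inv.
by case: pselect.
Qed.

HB.instance Definition _ := GRing.ComNzRing_hasMulInverse.Build fps fps_mulVx fps_unitPl fps_invr_out.

Lemma fps_neq0 (a : fps) : a != 0 -> exists k, fcoef a k != 0.
Proof.
move=> a0; have [//|H] := pselect (exists k, fcoef a k != 0).
exfalso; move/eqP: a0; apply; apply: fpsP => k /=.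
by apply/eqP/negPn/negP => Hk; apply: H; exists k.
Qed.

Fact fps_idomain : GRing.integral_domain_axiom fps.
Proof.
move=> a b ab0; apply/norP => -[/fps_neq0 Ha /fps_neq0 Hb].
pose i := ex_minn Ha; pose j := ex_minn Hb.
have [ai imin] : fcoef a i != 0 /\ forall m, fcoef a m != 0 -> (i <= m)%N.
  by rewrite /i; case: ex_minnP.
have [bj jmin] : fcoef b j != 0 /\ forall m, fcoef b m != 0 -> (j <= m)%N.
  by rewrite /j; case: ex_minnP.
have : fcoef (a * b) (i + j) = fcoef a i * fcoef b j.
  rewrite /= (bigD1 (@Ordinal (i+j).+1 i (leq_addr j i))) //=.
  rewrite (_ : (i + j - i)%N = j); last by rewrite addKn.
  rewrite big1 ?addr0 // => k /eqP kneq.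
  have [ki|ik] := ltnP k i.
    have -> : fcoef a k = 0 by apply/eqP/negPn/negP => /imin; rewrite leqNgt ki.
    by rewrite mul0r.
  have ki : (i < k)%N by rewrite ltn_neqAle ik andbT eq_sym; apply/eqP => E; apply: kneq; apply: val_inj.
  have -> : fcoef b (i + j - k) = 0.
    apply/eqP/negPn/negP => /jmin; rewrite leqNgt.
    by move/negP; apply; rewrite ltn_subLR ?ltn_add2r // -ltnS; apply: ltn_ord.
  by rewrite mulr0.
by rewrite ab0 /= => /esym/eqP; rewrite mulf_eq0 (negbTE ai) (negbTE bj).
Qed.

HB.instance Definition _ := GRing.ComUnitRing_isIntegral.Build fps fps_idomain.

End FPS.

Arguments FPS {F}.

Definition RR : Type := Rdefinitions.R.
Definition CC : fieldType := (complex Rdefinitions.R).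

(* The field of formal Laurent series C((s)) = Frac(C[[s]]).  The Puiseux
   series field C{{t}} is the union over N >= 1 of C((s)) with s = t^(1/N);
   a point of K^S has coordinates in a common C((t^(1/N))). *)
Definition laurent : fieldType := {fraction (fps CC)}.

Definition toL (a : fps CC) : laurent := @FracField.tofrac (fps CC) a.

Definition fps_const (c : CC) : fps CC := FPS (fun k => if k == 0%N then c else 0).
Definition laurent_const (c : CC) : laurent := toL (fps_const c).

Definition fps_ord (a : fps CC) (k : nat) : Prop :=
  fcoef a k != 0 /\ forall j, (j < k)%N -> fcoef a j = 0.

Definition laurent_ord (x : laurent) (r : int) : Prop :=
  exists (a b : fps CC) (ka kb : nat),
    [/\ fps_ord a ka, fps_ord b kb, x = toL a / toL b & r = ka%:Z - kb%:Z].

(* Tropicalization (max convention) of the variety of an ideal I of         *)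
(* C[x_e : e in S], S a finite index type; variable i of the mpoly ring     *)
(* corresponds to the coordinate enum_val i of S.                           *)
Definition polyS (S : finType) := mpoly.mpoly #|{: S}| CC.

(* valuation points: val(x_e) = -(ord_s x_e)/N for x in V_K(I) with all
   coordinates nonzero (the intersection with R^S). *)
Definition trop_val_pts (S : finType) (I : polyS S -> Prop) (w : S -> RR) : Prop :=
  exists (N : nat) (x : S -> laurent),
    [/\ (0 < N)%N,
        (forall f, I f -> mpoly.mmap laurent_const (fun i => x (enum_val i)) f = 0)
      & forall e, exists r : int, laurent_ord (x e) r /\ w e = - (r%:~R / N%:R)].

Definition eucl_closure (S : finType) (A : (S -> RR) -> Prop) (w : S -> RR) : Prop :=
  forall eps : RR, 0 < eps ->
    exists w', A w' /\ forall e, `|w e - w' e| < eps.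

Definition trop (S : finType) (I : polyS S -> Prop) : (S -> RR) -> Prop :=
  eucl_closure (trop_val_pts I).

Definition pair (n : nat) := {p : 'I_n * 'I_n | (p.1 < p.2)%N}.

Definition sqdist (n d : nat) (p : 'I_n -> 'I_d -> RR) (e : pair n) : RR :=
  \sum_(i < d) (p (val e).1 i - p (val e).2 i) ^+ 2.

(* the ideal of CM_n^d = ideal of the Zariski closure of the set of squared
   distance vectors of configurations of n real points in R^d, i.e. the
   polynomials vanishing on that set *)
Definition CM_ideal (n d : nat) (f : polyS (pair n)) : Prop :=
  forall p : 'I_n -> 'I_d -> RR,
    mpoly.meval (fun i => (Complex (sqdist p (enum_val i)) 0 : CC)) f = 0.

Inductive rtree := Leaf of nat | Node of seq rtree.

Fixpoint leaves (t : rtree) : seq nat :=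
  match t with Leaf i => [:: i] | Node ts => flatten (map leaves ts) end.

Fixpoint wf_tree (t : rtree) : bool :=
  match t with Leaf _ => true | Node ts => (2 <= size ts)%N && all wf_tree ts end.

Fixpoint clades_seq (t : rtree) : seq (seq nat) :=
  match t with
  | Leaf _ => [::]
  | Node ts => flatten (map leaves ts) :: flatten (map clades_seq ts)
  end.

Definition rooted_tree (n : nat) (t : rtree) : bool :=
  wf_tree t && perm_eq (leaves t) (iota 0 n).

Definition clade (n : nat) (t : rtree) : {set {set 'I_n}} :=
  [set:: [seq [set i : 'I_n | val i \in c] | c <- clades_seq t]].

Definition TP_face (n : nat) (F : {set {set 'I_n}}) : Prop :=
  exists t1 t2, [/\ rooted_tree n t1, rooted_tree n t2 &
                    F \subset clade n t1 :|: clade n t2].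

(* Cones are represented by their preimages in R^S (they contain R*1).      *)
(* The vertex [n] (= setT, contained in every maximal face) is the cone     *)
(* apex, realised by the lineality space R*1.                *)
Definition fan_cone (n : nat) (v : {set 'I_n} -> pair n -> RR)
    (F : {set {set 'I_n}}) (w : pair n -> RR) : Prop :=
  exists (lam : {set 'I_n} -> RR) (mu : RR),
    (forall A, A \in F -> A != setT -> 0 <= lam A) /\
    forall e, w e = \sum_(A in F | A != setT) lam A * v A e + mu.

Definition is_simplicial_fan_structure_TP (n : nat) (X : (pair n -> RR) -> Prop)
    (v : {set 'I_n} -> pair n -> RR) : Prop :=
  [/\
      (forall F, TP_face F -> forall (lam : {set 'I_n} -> RR) (mu : RR),
         (forall e, \sum_(A in F | A != setT) lam A * v A e = mu) ->
         forall A, A \in F -> A != setT -> lam A = 0),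
      (forall F G, TP_face F -> TP_face G -> forall w,
         fan_cone v F w /\ fan_cone v G w <-> fan_cone v (F :&: G) w)
    &
      (forall w, X w <-> exists F, TP_face F /\ fan_cone v F w)].

Arguments CM_ideal : clear implicits.
Arguments trop : clear implicits.

(* Main.v *)
Require Import Defs.
From HB Require Import structures.
From mathcomp Require Import all_boot all_order all_algebra.
From mathcomp Require Import boolp Rstruct.
From mathcomp.real_closed Require Import complex.
From mathcomp Require Import fraction ring lra zify.
From mathcomp Require Import mpoly.
Set Implicit Arguments. Unset Strict Implicit. Unset Printing Implicit Defensive.
Import Order.TTheory GRing.Theory Num.Theory.
Local Open Scope ring_scope.

(* Over C the squared distance (x_u - x_v)^2 + (y_u - y_v)^2 factors as
   (a_u - a_v)(b_u - b_v), so valuations of points of CM_n^2 are sums of two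
   ultrametrics, i.e. of the data of two rooted trees; the ray of a clade A is
   minus the indicator of the pairs contained in A.

   Points to cones: a point of the variety over K has a Gram matrix of rank at
   most 2, hence x_uv = al (p_u - p_v)^2 + be (q_u - q_v)^2 over K itself.  If
   - be / al is a square the form splits into two linear factors; otherwise
   - be / al has odd order, the two terms never cancel, and val(x_uv) is itself
   an ultrametric, which is twice its half.

   Cones to points: every integral ultrametric is (ord (a_u - a_v)) for some
   power series a_u, and rational points are dense in the cones.

   Simpliciality: let c be nonnegative and supported on a union of two laminar
   families, and let t(S) be the sum of the c(A) over A containing S.  Among the
   supporting sets that meet S in S minus a point, those of one laminar family
   all omit the same point as soon as |S| > 2; hence t(S) = t(S - x) for some x,
   so t(S) is the minimum of t over the pairs in S.  Thus t, and by inversion c,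
   depends only, and continuously, on the values on pairs: coordinates are
   unique and the union of the cones is closed. *)

(** * Valuation on Laurent series *)

Section FpsOrder.
Implicit Types (a b : fps CC) (i j k : nat).

Lemma fps_ord_ex a : a != 0 -> exists k, fps_ord a k.
Proof.
move=> /fps_neq0 H; case: (ex_minnP H) => k ak kmin.
exists k; split=> // j jk; apply/eqP/negPn/negP => /kmin.
by rewrite leqNgt jk.
Qed.

Lemma fps_ord_neq0 a k : fps_ord a k -> a != 0.
Proof. by case=> ak _; apply: contraNneq ak => ->. Qed.

Lemma fps_ord_le a i j : fps_ord a i -> fcoef a j != 0 -> (i <= j)%N.
Proof. by move=> [_ ai]; apply: contraNT; rewrite -ltnNge => /ai ->. Qed.

Lemma fps_ord_uniq a i j : fps_ord a i -> fps_ord a j -> i = j.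
Proof.
move=> ai aj; apply/eqP; rewrite eqn_leq (fps_ord_le ai aj.1).
by rewrite (fps_ord_le aj ai.1).
Qed.

Lemma fps_ordM a b i j : fps_ord a i -> fps_ord b j -> fps_ord (a * b) (i + j).
Proof.
move=> [ai alt] [bj blt]; split=> [|k kij] /=.
  have lei : (i < (i + j).+1)%N by rewrite ltnS leq_addr.
  rewrite (bigD1 (Ordinal lei)) //= addKn big1 ?addr0 ?mulf_neq0 // => l /eqP nl.
  have [li|il] := ltnP l i; first by rewrite alt ?mul0r.
  rewrite [fcoef b _]blt ?mulr0 //.
  suff : (l : nat) <> i by have := ltn_ord l; lia.
  by move=> e; apply: nl; apply: val_inj.
rewrite big1 // => l _; have [li|il] := ltnP l i; first by rewrite alt ?mul0r.
by rewrite [fcoef b _]blt ?mulr0 //; have := ltn_ord l; lia.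
Qed.

Lemma fps_ordD a b i j k :
  fps_ord a i -> fps_ord b j -> fps_ord (a + b) k -> (minn i j <= k)%N.
Proof.
move=> [_ ai] [_ bj] [abk _]; rewrite leqNgt; apply: contraNN abk => /=.
by rewrite leq_min => /andP[ki kj]; rewrite /= ai // bj // addr0.
Qed.

End FpsOrder.

HB.instance Definition _ := GRing.isZmodMorphism.Build (fps CC) laurent toL
  (@tofrac_is_zmod_morphism (fps CC)).
HB.instance Definition _ := GRing.isMonoidMorphism.Build (fps CC) laurent toL
  (@tofrac_is_monoid_morphism (fps CC)).

Lemma toL_eq0 a : (toL a == 0) = (a == 0).
Proof. exact: tofrac_eq0. Qed.

Lemma fraction_div (R : idomainType) (x : {fraction R}) :
  exists a b : R, b != 0 /\ x = @FracField.tofrac R a / @FracField.tofrac R b.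
Proof.
elim/quotW: x => r; exists (frac r).1, (frac r).2.
have d0 := denom_ratioP r; split=> //.
apply: (canRL (mulfK _)); first by rewrite tofrac_eq0.
unlock FracField.tofrac; rewrite -[LHS]FracField.pi_mul; apply/eqmodP => /=.
rewrite FracField.equivfE /FracField.mulf /=.
by rewrite !numden_Ratio ?mulf_neq0 ?oner_eq0 // !mulr1 mulrC.
Qed.

Lemma laurent_frac (x : laurent) :
  exists a b : fps CC, b != 0 /\ x = toL a / toL b.
Proof. exact: fraction_div. Qed.

Section LaurentVal.
Implicit Types x y z : laurent.

Lemma laurent_ord_ex x : x != 0 -> exists r, laurent_ord x r.
Proof.
have [a [b [b0 ->]]] := laurent_frac x.
rewrite mulf_eq0 invr_eq0 !toL_eq0 (negPf b0) orbF => a0.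
have [[i ai] [j bj]] := (fps_ord_ex a0, fps_ord_ex b0).
by exists (i%:Z - j%:Z), a, b, i, j.
Qed.

Lemma laurent_ord_neq0 x r : laurent_ord x r -> x != 0.
Proof.
move=> [a [b [i [j [/fps_ord_neq0 a0 /fps_ord_neq0 b0 -> _]]]]].
by rewrite mulf_eq0 invr_eq0 !toL_eq0 negb_or a0.
Qed.

Lemma laurent_ord_uniq x r s : laurent_ord x r -> laurent_ord x s -> r = s.
Proof.
move=> [a [b [i [j [ai bj -> ->]]]]] [c [d [k [l [ck dl E ->]]]]].
have [b0 d0] := (fps_ord_neq0 bj, fps_ord_neq0 dl).
have /eqP : toL (a * d) = toL (c * b).
  by apply/eqP; rewrite !rmorphM -eqr_div ?toL_eq0 // E.
rewrite /toL tofrac_eq => /eqP E'.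
have := fps_ordM ai dl; rewrite E' => /fps_ord_uniq/(_ (fps_ordM ck bj)).
by lia.
Qed.

Lemma laurent_ordM x y r s :
  laurent_ord x r -> laurent_ord y s -> laurent_ord (x * y) (r + s).
Proof.
move=> [a [b [i [j [ai bj -> ->]]]]] [c [d [k [l [ck dl -> ->]]]]].
exists (a * c), (b * d), (i + k)%N, (j + l)%N; split; [exact: fps_ordM..| |].
  by rewrite !rmorphM invfM mulrACA.
by lia.
Qed.

Lemma laurent_ordD x y r s t : laurent_ord x r -> laurent_ord y s ->
  laurent_ord (x + y) t -> Num.min r s <= t.
Proof.
move=> [a [b [i [j [ai bj Ex ->]]]]] [c [d [k [l [ck dl Ey ->]]]]] Ht.
have [b0 d0] := (fps_ord_neq0 bj, fps_ord_neq0 dl).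
have E : x + y = toL (a * d + c * b) / toL (b * d).
  by rewrite Ex Ey rmorphD !rmorphM /= addf_div ?toL_eq0 // mulrC.
have s0 : a * d + c * b != 0.
  have := laurent_ord_neq0 Ht; rewrite E; apply: contraNneq => ->.
  by rewrite rmorph0 mul0r.
have [m sm] := fps_ord_ex s0.
have Ht' : laurent_ord (x + y) (m%:Z - (j + l)%N%:Z).
  by exists (a * d + c * b), (b * d), m, (j + l)%N; split=> //; exact: fps_ordM.
rewrite (laurent_ord_uniq Ht Ht').
by have := fps_ordD (fps_ordM ai dl) (fps_ordM ck bj) sm; lia.
Qed.

(* [lval 0] is a junk value. *)
Definition lval x : int :=
  if pselect (exists r, laurent_ord x r) is left H then projT1 (cid H) else 0.

Lemma lvalP x : x != 0 -> laurent_ord x (lval x).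
Proof.
move=> /laurent_ord_ex Hx; rewrite /lval; case: pselect => // H.
by case: (cid H).
Qed.

Lemma lval_uniq x r : laurent_ord x r -> lval x = r.
Proof. by move=> H; apply: laurent_ord_uniq (lvalP (laurent_ord_neq0 H)) H. Qed.

Lemma lvalM x y : x != 0 -> y != 0 -> lval (x * y) = lval x + lval y.
Proof. by move=> x0 y0; apply/lval_uniq/laurent_ordM; apply: lvalP. Qed.

Lemma lvalD x y : x != 0 -> y != 0 -> x + y != 0 ->
  Num.min (lval x) (lval y) <= lval (x + y).
Proof. by move=> x0 y0 s0; apply: laurent_ordD; apply: lvalP. Qed.

Lemma lval_toL a k : fps_ord a k -> lval (toL a) = k%:Z.
Proof.
move=> ak; apply: lval_uniq; exists a, 1, k, 0%N; split=> //.
- by split=> //=; exact: oner_neq0.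
- by rewrite rmorph1 divr1.
- by rewrite subr0.
Qed.

Lemma lvalN x : lval (- x) = lval x.
Proof.
have [->|x0] := eqVneq x 0; first by rewrite oppr0.
rewrite -mulN1r lvalM ?oppr_eq0 ?oner_neq0 //.
suff -> : lval (-1) = 0 by rewrite add0r.
have -> : -1 = toL (-1) by rewrite rmorphN rmorph1.
by apply: lval_toL; split=> //=; rewrite oppr_eq0; exact: oner_neq0.
Qed.

(** Zero satisfies this for every [m], as if its valuation were plus infinity; the junk value of
    [lval 0] thus stays out of the triangle inequality. *)
Definition lval_ge x (m : int) : bool := (x == 0) || (m <= lval x).

Lemma lval_geD x y m : lval_ge x m -> lval_ge y m -> lval_ge (x + y) m.
Proof.
rewrite /lval_ge; have [->|x0] := eqVneq x 0; first by rewrite add0r.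
have [->|y0] := eqVneq y 0; first by rewrite addr0 (negPf x0).
have [//|s0] := eqVneq (x + y) 0; rewrite /= => mx my.
by apply: le_trans (lvalD x0 y0 s0); rewrite le_min mx.
Qed.

Lemma lval_geN x m : lval_ge (- x) m = lval_ge x m.
Proof. by rewrite /lval_ge oppr_eq0 lvalN. Qed.

(** The cross term is two copies of [d * (x * y)], whose valuation is the mean of those of
    [d * x ^+ 2] and [d * y ^+ 2], hence at least [m]. *)
Lemma lval_ge_sqrD d x y m : lval_ge (d * x ^+ 2) m -> lval_ge (d * y ^+ 2) m ->
  lval_ge (d * (x + y) ^+ 2) m.
Proof.
move=> xm ym; have -> : d * (x + y) ^+ 2 =
    d * x ^+ 2 + d * y ^+ 2 + (d * (x * y) + d * (x * y)) by ring.
have M3 z t : d != 0 -> z != 0 -> t != 0 ->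
    lval_ge (d * (z * t)) m = (m <= lval d + (lval z + lval t)).
  move=> d0 z0 t0; have zt0 := mulf_neq0 z0 t0.
  by rewrite /lval_ge (negPf (mulf_neq0 d0 zt0)) (lvalM d0 zt0) (lvalM z0 t0).
suff xym : lval_ge (d * (x * y)) m.
  exact: lval_geD (lval_geD xm ym) (lval_geD xym xym).
have ge0 : lval_ge 0 m by rewrite /lval_ge eqxx.
have [->|d0] := eqVneq d 0; first by rewrite mul0r.
have [->|x0] := eqVneq x 0; first by rewrite mul0r mulr0.
have [->|y0] := eqVneq y 0; first by rewrite !mulr0.
move: xm ym; rewrite !expr2 !M3 //; clear => mx my; lia.
Qed.

(* Distinct valuations cannot cancel. *)
Lemma lval_ge_parts x y m : (x != 0 -> y != 0 -> lval x != lval y) ->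
  lval_ge (x + y) m -> lval_ge x m.
Proof.
move=> nxy; rewrite /lval_ge; have [//|x0] := eqVneq x 0.
have [->|y0] := eqVneq y 0; first by rewrite addr0 (negPf x0).
have {nxy} nxy := nxy x0 y0.
have [/eqP|s0 /= ms] := eqVneq (x + y) 0.
  by rewrite addr_eq0 => /eqP E; rewrite E lvalN eqxx in nxy.
have [//|lt_xm] := leP m (lval x).
have [lxy|lyx] := ltP (lval x) (lval y).
  have := @lvalD (x + y) (- y) s0; rewrite oppr_eq0 lvalN addrK => /(_ y0 x0).
  by lia.
(* Here [lval y <= lval x < m <= lval (x + y)], and y = (x + y) - x gives [lval x <= lval y]: the
   valuations coincide, which is excluded. *)
have := @lvalD (x + y) (- x) s0.
rewrite oppr_eq0 lvalN [x + y]addrC addrK => /(_ x0 y0).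
rewrite [y + x]addrC (min_idPr (ltW (lt_le_trans lt_xm ms))) => lxy.
by case/eqP: nxy; apply: le_anti; rewrite lxy lyx.
Qed.

End LaurentVal.

(** * Square roots and prescribed valuations *)

Lemma CC_natS_neq0 k : (k.+1%:R : CC) != 0.
Proof. apply/negbT; exact: (@pnatr_eq0 (complex Rdefinitions.R) k.+1). Qed.

Section FpsSqrt.
Variable u : fps CC.
Hypothesis u0 : fcoef u 0 != 0.

Let r0 : CC := sqrtc (fcoef u 0 : complex Rdefinitions.R).

Let r0_sqr : r0 * r0 = fcoef u 0.
Proof. by rewrite -expr2; exact: sqr_sqrtc. Qed.

Let two_r0_neq0 : r0 + r0 != 0.
Proof.
rewrite -mulr2n -mulr_natl mulf_neq0 //.
  exact: CC_natS_neq0.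
by apply: contraNneq u0 => r00; rewrite -r0_sqr r00 mul0r.
Qed.

(** In the square of a series v with constant term [r0], the coefficient of index m + 1 is 2 [r0]
    v_(m+1) plus products of earlier coefficients; this solves for v_(m+1). All earlier coefficients
    are needed, so the recursion runs on lists of initial segments. *)
Let next (s : seq CC) k : CC :=
  if k is m.+1 then
    (fcoef u m.+1 - \sum_(j < m) s`_j.+1 * s`_(m - j)) / (r0 + r0)
  else r0.

Let Fixpoint coefs k : seq CC :=
  if k is m.+1 then rcons (coefs m) (next (coefs m) m) else [::].

Let size_coefs k : size (coefs k) = k.
Proof. by elim: k => //= k IH; rewrite size_rcons IH. Qed.

Let r k : CC := (coefs k.+1)`_k.

Let rE k : r k = next (coefs k) k.
Proof. by rewrite /r /= nth_rcons size_coefs ltnn eqxx. Qed.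

Let coefs_nth k j : (j < k)%N -> (coefs k)`_j = r j.
Proof.
elim: k => // k IH; rewrite ltnS leq_eqVlt => /predU1P[->//|jk].
by rewrite /= nth_rcons size_coefs jk IH.
Qed.

Lemma fps_sqrt : exists v : fps CC, v * v = u.
Proof.
exists (FPS r); apply: fpsP => -[|k] /=.
  by rewrite big_ord1 !rE.
rewrite big_ord_recl big_ord_recr /= subn0 subnn addrCA [r 0]rE /=.
have -> : \sum_(i < k) r (bump 0 i) * r (k.+1 - bump 0 i)
    = \sum_(j < k) (coefs k.+1)`_j.+1 * (coefs k.+1)`_(k - j).
  apply: eq_bigr => j _; have jk := ltn_ord j; rewrite !coefs_nth //; lia.
rewrite [r k.+1 * _]mulrC -mulrDl rE /next mulrC divfK //.
by rewrite addrCA subrr addr0.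
Qed.

End FpsSqrt.

Definition fpsXn (l : nat) : fps CC := FPS (fun k => (k == l)%:R).

Lemma coef_fpsXnM l a k :
  fcoef (fpsXn l * a) k = if (k < l)%N then 0 else fcoef a (k - l).
Proof.
rewrite /=; case: ltnP => [kl|lk].
  by rewrite big1 // => j _; rewrite ltn_eqF ?mul0r //; have := ltn_ord j; lia.
rewrite (bigD1 (Ordinal (lk : l < k.+1)%N)) //= eqxx mul1r big1 ?addr0 // => j nj.
by rewrite [_ == l](negbTE nj) mul0r.
Qed.

Lemma fpsXn_ord l : fps_ord (fpsXn l) l.
Proof. by split=> /= [|j jl]; rewrite ?eqxx ?oner_neq0 // ltn_eqF. Qed.

(** Dividing by s^(2l) leaves a unit; its root is then multiplied by s^l. *)
Lemma fps_sqrt_even a l : fps_ord a (l + l) -> exists b : fps CC, b * b = a.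
Proof.
move=> [al alt]; have [|v vE] := @fps_sqrt (FPS (fun k => fcoef a (k + (l + l)))).
  exact: al.
exists (fpsXn l * v); rewrite mulrACA vE -mulrA.
apply: fpsP => k; rewrite coef_fpsXnM; case: ltnP => [kl|lk].
  by rewrite alt //; lia.
rewrite coef_fpsXnM; case: ltnP => [kl|lk']; first by rewrite alt //; lia.
by congr (fcoef a _); lia.
Qed.

Lemma laurent_sqrt_even (x : laurent) (m : int) :
  x != 0 -> lval x = m + m -> exists y, y * y = x.
Proof.
move=> /lvalP [a [b [i [j [ai bj -> ->]]]]] ijm.
have b0 := fps_ord_neq0 bj.
(* Since i - j = 2m, the order i + j of [a * b] is 2(j + m), so j + m is nonnegative and the
   absolute value only makes it a natural number. A root c of a b gives the root c / b of a / b. *)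
have abo : fps_ord (a * b) (`|j%:Z + m| + `|j%:Z + m|).
  by have := fps_ordM ai bj; congr (fps_ord _ _); lia.
have [c cE] := fps_sqrt_even abo; exists (toL c / toL b).
rewrite mulrACA -invfM -!rmorphM cE /= rmorphM.
by rewrite rmorphM /= invfM mulrA mulfK // toL_eq0.
Qed.

Lemma laurent_val_surj (m : int) : exists2 x : laurent, x != 0 & lval x = m.
Proof.
have one_ord : fps_ord (1 : fps CC) 0 by split=> //=; exact: oner_neq0.
suff [x xm] : exists x, laurent_ord x m.
  by exists x; [exact: laurent_ord_neq0 xm | exact: lval_uniq].
case: m => k; [exists (toL (fpsXn k) / toL 1), (fpsXn k), 1, k, 0%N
             | exists (toL 1 / toL (fpsXn k.+1)), 1, (fpsXn k.+1), 0%N, k.+1];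
  split=> //; try exact: fpsXn_ord; by rewrite ?subr0 ?sub0r // NegzE.
Qed.

(** * Valuations of diagonal quadratic forms *)

(** [D] behaves like the valuation of a difference: larger means closer, so the inequality bounds
    from below by a minimum. The points are distinct because the diagonal would carry [lval 0]. *)
Definition ultrametric n (D : 'I_n -> 'I_n -> RR) : Prop :=
  (forall u v, D u v = D v u) /\
  (forall u v w, u != v -> v != w -> u != w -> Num.min (D u v) (D v w) <= D u w).

Lemma mulf_neq0_inv (F : idomainType) (x y : F) : x * y != 0 -> x != 0 /\ y != 0.
Proof. by rewrite mulf_eq0 negb_or => /andP. Qed.

Lemma mulf_sqr_neq0_inv (F : idomainType) (x y : F) :
  x * y ^+ 2 != 0 -> x != 0 /\ y != 0.
Proof. by rewrite mulf_eq0 expf_eq0 negb_or => /andP. Qed.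

Lemma intr_ultrametric n (D : 'I_n -> 'I_n -> int) :
  (forall u v, D u v = D v u) ->
  (forall u v w, u != v -> v != w -> u != w -> Num.min (D u v) (D v w) <= D u w) ->
  ultrametric (fun u v => (D u v)%:~R).
Proof.
move=> Dsym Dult; split=> [u v|u v w uv vw uw]; first by rewrite Dsym.
have := Dult u v w uv vw uw; rewrite !ge_min => /orP[H|H]; apply/orP.
  by left; rewrite ler_int.
by right; rewrite ler_int.
Qed.

Lemma lval_sub_ultrametric n (a : 'I_n -> laurent) :
  (forall u v, u != v -> a u - a v != 0) ->
  ultrametric (fun u v => (lval (a u - a v))%:~R).
Proof.
move=> a0; apply: intr_ultrametric => [u v|u v w uv vw uw].
  by rewrite -lvalN opprB.
have E : a u - a w = (a u - a v) + (a v - a w) by rewrite addrA subrK.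
by rewrite E lvalD ?a0 // -E a0.
Qed.

Section DiagonalForm.
Variables (n : nat) (al be : laurent) (p q : 'I_n -> laurent).
Let X u v := al * (p u - p v) ^+ 2 + be * (q u - q v) ^+ 2.
Hypotheses (al0 : al != 0) (X0 : forall u v, u != v -> X u v != 0).

Let Xsym u v : X u v = X v u.
Proof. by rewrite /X -(opprB (p v)) -(opprB (q v)) !sqrrN. Qed.

Lemma split_form_val (g : laurent) : al * (g * g) = - be ->
  exists D1 D2, [/\ ultrametric D1, ultrametric D2 &
    forall u v, u != v -> (lval (X u v))%:~R = D1 u v + D2 u v + (lval al)%:~R].
Proof.
move=> gE; pose a u := p u + g * q u; pose b u := p u - g * q u.
have XE u v : X u v = al * ((a u - a v) * (b u - b v)).
  by rewrite /X /a /b -[be]opprK -gE; ring.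
have ab0 u v : u != v -> a u - a v != 0 /\ b u - b v != 0.
  by move=> /X0; rewrite XE => /mulf_neq0_inv[_ /mulf_neq0_inv].
exists (fun u v => (lval (a u - a v))%:~R), (fun u v => (lval (b u - b v))%:~R).
split; try by apply: lval_sub_ultrametric => u v /ab0[].
move=> u v /ab0[au bu]; rewrite XE (lvalM al0 (mulf_neq0 au bu)) (lvalM au bu).
by rewrite !intrD addrC.
Qed.

(** The two summands of the form have valuations of different parity, so a lower bound on the form
    passes to each summand. Each is a scaled square of a difference, obeys the triangle inequality,
    and the bounds add up again. *)
Lemma odd_form_ultrametric :
  (be != 0 -> forall m, lval be != lval al + (m + m)) ->
  ultrametric (fun u v => (lval (X u v))%:~R).
Proof.
move=> odd_be; apply: intr_ultrametric => [u v|u v w uv vw uw].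
  by rewrite Xsym.
set m := Num.min _ _.
have parts u' v' : lval_ge (X u' v') m ->
    lval_ge (al * (p u' - p v') ^+ 2) m /\ lval_ge (be * (q u' - q v') ^+ 2) m.
  have ne : al * (p u' - p v') ^+ 2 != 0 -> be * (q u' - q v') ^+ 2 != 0 ->
      lval (al * (p u' - p v') ^+ 2) != lval (be * (q u' - q v') ^+ 2).
    move=> /mulf_sqr_neq0_inv[_ p0] /mulf_sqr_neq0_inv[be0 q0].
    rewrite !expr2 (lvalM al0 (mulf_neq0 p0 p0)) (lvalM be0 (mulf_neq0 q0 q0)).
    rewrite (lvalM p0 p0) (lvalM q0 q0); apply/eqP => E.
    have /eqP[] := odd_be be0 (lval (p u' - p v') - lval (q u' - q v')).
    by move: E; clear; lia.
  move=> Xm; split; first exact: lval_ge_parts ne Xm.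
  apply: (@lval_ge_parts _ (al * (p u' - p v') ^+ 2)); last by rewrite addrC.
  by move=> b0 a0; rewrite eq_sym ne.
have Xuv : lval_ge (X u v) m by rewrite /lval_ge /m ge_min lexx orbT.
have Xvw : lval_ge (X v w) m by rewrite /lval_ge /m ge_min lexx !orbT.
have [puv quv] := parts _ _ Xuv; have [pvw qvw] := parts _ _ Xvw.
have : lval_ge (X u w) m.
  have E (f : 'I_n -> laurent) : f u - f w = (f u - f v) + (f v - f w).
    by rewrite addrA subrK.
  by rewrite /X (E p) (E q); apply: lval_geD; apply: lval_ge_sqrD.
by rewrite /lval_ge (negPf (X0 uw)).
Qed.

Lemma diagonal_form_val :
  exists D1 D2 c, [/\ ultrametric D1, ultrametric D2 &
    forall u v, u != v -> (lval (X u v))%:~R = D1 u v + D2 u v + c].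
Proof.
(* The case [be = 0] belongs to the first branch, with [g = 0]. *)
have [[g gE]|nsq] := pselect (exists g, al * (g * g) = - be).
  have [D1 [D2 [u1 u2 E]]] := split_form_val gE.
  by exists D1, D2, (lval al)%:~R.
have odd_be : be != 0 -> forall m, lval be != lval al + (m + m).
  move=> be0 m; apply/eqP => E; apply: nsq.
  have d0 : - (be / al) != 0 by rewrite oppr_eq0 mulf_neq0 ?invr_eq0.
  have [|y yE] := @laurent_sqrt_even _ m d0; last first.
    by exists y; rewrite yE mulrN mulrC divfK.
  apply: (addrI (lval al)); rewrite -E -(lvalM al0 d0).
  by rewrite mulrN mulrC divfK // lvalN.
have [usym uult] := odd_form_ultrametric odd_be.
pose D u v : RR := (lval (X u v))%:~R / 2%:R.
have Du : ultrametric D.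
  split=> [u v|u v w uv vw uw]; first by rewrite /D usym.
  have := uult u v w uv vw uw; rewrite /D !ge_min => /orP[H|H]; apply/orP.
    by left; rewrite ler_pM2r ?invr_gt0 ?ltr0n.
  by right; rewrite ler_pM2r ?invr_gt0 ?ltr0n.
exists D, D, 0; split=> // u v _.
by rewrite /D addr0; exact: splitr.
Qed.

End DiagonalForm.

(** * The Cayley-Menger ideal *)

Section VanishingOnNaturals.
Variables (K : idomainType) (J : finType).
Hypothesis charK0 : forall k, (k.+1%:R : K) != 0.

Lemma natr_inj : injective (fun k : nat => k%:R : K).
Proof.
move=> i j /=; wlog ij : i j / (i <= j)%N => [H E|].
  by have [/H|/ltnW/H] := leqP i j => [|H']; [exact | exact/esym/H'].
move=> E; apply/eqP; rewrite eqn_leq ij /= leqNgt; apply/negP => lt_ij.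
have := charK0 (j - i).-1; rewrite prednK ?subn_gt0 //.
by rewrite natrB // E subrr eqxx.
Qed.

Lemma poly_nat_roots (p : {poly K}) : (forall k : nat, p.[k%:R] = 0) -> p = 0.
Proof.
move=> pk; apply/eqP/negPn/negP => p0.
have := @max_poly_roots _ p [seq k%:R | k <- iota 0 (size p)] p0.
rewrite size_map size_iota ltnn => H.
suff : false by []; apply: H.
  by apply/allP => _ /mapP[k _ ->]; rewrite /root pk.
by rewrite (map_inj_uniq natr_inj) iota_uniq.
Qed.

Definition fupd (a : J -> K) j z : J -> K := fun j' => if j' == j then z else a j'.

(** The ideal only knows real points; this carries its equations to other fields. A univariate
    polynomial vanishing at all naturals is zero, so coordinates can be freed from being natural one
    at a time, and polynomiality in each variable separately suffices. *)
Lemma vanish_on_naturals (g : (J -> K) -> K) :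
  (forall a b, a =1 b -> g a = g b) ->
  (forall a j, exists p : {poly K}, forall z, g (fupd a j z) = p.[z]) ->
  (forall k : J -> nat, g (fun j => (k j)%:R) = 0) ->
  forall a, g a = 0.
Proof.
move=> gext gpoly gnat.
(* [s] lists the coordinates already free to be arbitrary. *)
suff H (s : seq J) : forall a : J -> K,
    (forall j, j \notin s -> exists k : nat, a j = k%:R) -> g a = 0.
  by move=> a; apply: (H (enum J)) => j; rewrite mem_enum.
elim: s => [|j s IH] a anat.
  have [k kE] := choice (fun j => anat j isT).
  by rewrite (gext _ _ kE) gnat.
have [p pE] := gpoly a j.
have pz : p = 0.
  apply: poly_nat_roots => k; rewrite -pE; apply: IH => j' j's; rewrite /fupd.
  have [_|j'j] := eqVneq; first by exists k.
  by apply: anat; rewrite inE negb_or j'j.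
rewrite (gext a (fupd a j (a j))); first by rewrite pE pz horner0.
by move=> j'; rewrite /fupd; case: eqVneq => // ->.
Qed.

End VanishingOnNaturals.

Lemma mmap_rmorph n (R S S' : nzRingType) (phi : {rmorphism S -> S'})
    (f : R -> S) (h : 'I_n -> S) (p : mpoly n R) :
  phi (mmap f h p) = mmap (phi \o f) (phi \o h) p.
Proof.
rewrite /mmap rmorph_sum; apply: eq_bigr => m _.
rewrite rmorphM /mmap1 rmorph_prod; congr (_ * _).
by apply: eq_bigr => i _; rewrite rmorphXn.
Qed.

Lemma eq_mmap n (R S : nzRingType) (f g : R -> S) (h k : 'I_n -> S) p :
  f =1 g -> h =1 k -> mmap f h p = mmap g k p.
Proof.
move=> fg hk; apply: eq_bigr => m _; rewrite fg; congr (_ * _).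
by apply: eq_bigr => i _; rewrite hk.
Qed.

Fact fps_const_zmod_morphism : zmod_morphism fps_const.
Proof. by move=> a b; apply: fpsP => -[|k] /=; rewrite ?subr0 // oppr0 addr0. Qed.
HB.instance Definition _ :=
  GRing.isZmodMorphism.Build CC (fps CC) fps_const fps_const_zmod_morphism.

Fact fps_const_monoid_morphism : monoid_morphism fps_const.
Proof.
split=> [|a b]; first by apply: fpsP => -[|k].
apply: fpsP => -[|k] /=; first by rewrite big_ord1.
by rewrite big_ord_recl mulr0 big1 ?addr0 // => i _; rewrite mul0r.
Qed.
HB.instance Definition _ :=
  GRing.isMonoidMorphism.Build CC (fps CC) fps_const fps_const_monoid_morphism.

HB.instance Definition _ := GRing.RMorphism.copy laurent_const (toL \o fps_const).

Lemma laurent_natS_neq0 k : (k.+1%:R : laurent) != 0.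
Proof.
by rewrite -(rmorph_nat laurent_const) fmorph_eq0 CC_natS_neq0.
Qed.

(** Composed with the squared distance map, [f] is a polynomial in the coordinates of the points. It
    vanishes at natural configurations, which are real, hence at all configurations over the Laurent
    series. *)
Lemma CM_ideal_sqdist n (f : polyS (pair n)) (a : 'I_n * 'I_2 -> laurent) :
  CM_ideal n 2 f ->
  mmap laurent_const (fun i => let e := val (enum_val i : pair n) in
    \sum_(c < 2) (a (e.1, c) - a (e.2, c)) ^+ 2) f = 0.
Proof.
move=> If.
pose h (K : comNzRingType) (b : 'I_n * 'I_2 -> K) (i : 'I_#|{: pair n}|) : K :=
  let e := val (enum_val i : pair n) in
  \sum_(c < 2) (b (e.1, c) - b (e.2, c)) ^+ 2.
have hext (K : comNzRingType) (b b' : 'I_n * 'I_2 -> K) : b =1 b' -> h K b =1 h K b'.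
  by move=> bb' i; apply: eq_bigr => c _; rewrite !bb'.
have hmor (K K' : comNzRingType) (phi : {rmorphism K -> K'}) b :
    phi \o h K b =1 h K' (phi \o b).
  move=> i; rewrite /h /= rmorph_sum; apply: eq_bigr => c _.
  by rewrite rmorphXn rmorphB.
apply: (vanish_on_naturals laurent_natS_neq0
  (g := fun a => mmap laurent_const (h laurent a) f)) => [b b' bb'|b j|k].
- by apply: eq_mmap => // i; apply: hext.
(* Putting an indeterminate at coordinate [j] and evaluating it at [z] gives [fupd b j z]. *)
- pose B j' : {poly laurent} := if j' == j then 'X else (b j')%:P.
  exists (mmap (polyC \o laurent_const) (h {poly laurent} B) f) => z.
  rewrite -[RHS]/(horner_eval z _) mmap_rmorph; apply: eq_mmap.
    by move=> c /=; rewrite /horner_eval hornerC.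
  move=> i; rewrite hmor; apply: hext => j' /=.
  by rewrite /fupd /B /horner_eval; case: eqP => _; rewrite ?hornerX ?hornerC.
pose P (u : 'I_n) (c : 'I_2) : RR := (k (u, c))%:R.
transitivity (laurent_const (meval
    (fun i => (Complex (sqdist P (enum_val i)) 0 : CC)) f)); last first.
  by rewrite If rmorph0.
rewrite /meval mmap_rmorph; apply: eq_mmap => // i /=.
transitivity (h laurent (laurent_const \o (fun j => (k j)%:R : CC)) i).
  by apply: hext => j /=; rewrite rmorph_nat.
rewrite -hmor /=; congr laurent_const.
have E x : (Complex x 0 : CC) = real_complex Rdefinitions.R x by [].
rewrite E /sqdist rmorph_sum; apply: eq_bigr => c _.
by rewrite rmorphXn rmorphB !rmorph_nat.
Qed.

(** With x = (a + b) / 2 and y = I (a - b) / 2, where I^2 = -1, the form x^2 + y^2 becomes a b, and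
    this change of coordinates is linear in the differences. *)
Lemma CM_ideal_product n (f : polyS (pair n)) (a b : 'I_n -> laurent) :
  CM_ideal n 2 f ->
  mmap laurent_const (fun i => let e := val (enum_val i : pair n) in
    (a e.1 - a e.2) * (b e.1 - b e.2)) f = 0.
Proof.
move=> If; pose I : laurent := laurent_const ('i%C : complex Rdefinitions.R).
have I2 : I * I = -1.
  have E : ('i%C * 'i%C : CC) = -1 by rewrite -expr2; exact: sqr_i.
  by rewrite -rmorphM E rmorphN rmorph1.
have t0 : (2%:R : laurent) != 0 := laurent_natS_neq0 1.
rewrite -[RHS](@CM_ideal_sqdist n f (fun uc => if uc.2 == 0
  then (a uc.1 + b uc.1) / 2%:R else I * (a uc.1 - b uc.1) / 2%:R)) //.
apply: eq_mmap => // i /=; rewrite big_ord_recl big_ord1 /=.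
set a1 := a _; set a2 := a _; set b1 := b _; set b2 := b _.
have -> : (I * (a1 - b1) / 2%:R - I * (a2 - b2) / 2%:R) ^+ 2 =
    (I * I) * ((a1 - b1) / 2%:R - (a2 - b2) / 2%:R) ^+ 2 by ring.
by rewrite I2; field.
Qed.

(** * Gram matrices of rank at most two *)

Definition sym_ext n (A : zmodType) (y : pair n -> A) (u v : 'I_n) : A :=
  if insub (u, v) is Some e then y e
  else if insub (v, u) is Some e then y e else 0.

Lemma sym_ext_diag n (A : zmodType) (y : pair n -> A) u : sym_ext y u u = 0.
Proof. by rewrite /sym_ext insubF //= ltnn. Qed.

Lemma sym_ext_pair n (A : zmodType) (y : pair n -> A) (e : pair n) :
  sym_ext y (val e).1 (val e).2 = y e.
Proof. by rewrite /sym_ext -surjective_pairing valK. Qed.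

Lemma sym_ext_morph n (A B : zmodType) (phi : {additive A -> B}) (y : pair n -> A) u v :
  phi (sym_ext y u v) = sym_ext (phi \o y) u v.
Proof. by rewrite /sym_ext; do 2![case: insub => [?|] //=]; rewrite ?raddf0. Qed.

Lemma eq_sym_ext n (A : zmodType) (y z : pair n -> A) u v :
  y =1 z -> sym_ext y u v = sym_ext z u v.
Proof. by move=> yz; rewrite /sym_ext; do 2![case: insub => [?|] //=]. Qed.

Lemma sym_ext_cases n (A : zmodType) (y : pair n -> A) (F : 'I_n -> 'I_n -> A) :
  (forall u v, F u v = F v u) -> (forall u, F u u = 0) ->
  (forall e : pair n, y e = F (val e).1 (val e).2) ->
  forall u v, sym_ext y u v = F u v.
Proof.
move=> Fs F0 yF u v; rewrite /sym_ext.
case: insubP => [e _ E|]; first by rewrite yF E.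
case: insubP => [e _ E _|]; first by rewrite yF E Fs.
rewrite /= -!leqNgt => uv vu; suff -> : u = v by rewrite F0.
by apply: val_inj; apply/eqP; rewrite eqn_leq uv.
Qed.

Section GramMinors.
Variables (n : nat) (R : comNzRingType) (y : pair n -> R) (o a : 'I_n).

(** Polarization: for squared distances this is twice the inner product of p_u - p_o and p_v -
    p_o. *)
Definition gram u v : R := sym_ext y o u + sym_ext y o v - sym_ext y u v.
Definition minor2 u v : R := gram a a * gram u v - gram u a * gram v a.
(** Two successive pivots, at [a] and at [k]: by Sylvester's identity this is [gram a a] times the 3
    by 3 minor of the Gram matrix on rows a, k, u and columns a, k, v. *)
Definition rank_defect k u v : R := minor2 k k * minor2 u v - minor2 u k * minor2 v k.

End GramMinors.

Lemma rank_defect_morph n (R R' : comNzRingType) (phi : {rmorphism R -> R'})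
    (y : pair n -> R) o a k u v :
  phi (rank_defect y o a k u v) = rank_defect (phi \o y) o a k u v.
Proof.
have G u' v' : phi (gram y o u' v') = gram (phi \o y) o u' v'.
  by rewrite /gram rmorphB rmorphD !sym_ext_morph.
have M u' v' : phi (minor2 y o a u' v') = minor2 (phi \o y) o a u' v'.
  by rewrite /minor2 rmorphB !rmorphM !G.
by rewrite /rank_defect rmorphB !rmorphM !M.
Qed.

Lemma eq_rank_defect n (R : comNzRingType) (y z : pair n -> R) o a k u v :
  y =1 z -> rank_defect y o a k u v = rank_defect z o a k u v.
Proof.
move=> yz; have E u' v' : sym_ext y u' v' = sym_ext z u' v' by exact: eq_sym_ext.
by rewrite /rank_defect /minor2 /gram !E.
Qed.

Lemma rank_defect_sqdist n (p : 'I_n -> 'I_2 -> RR) o a k u v :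
  rank_defect (sqdist p) o a k u v = 0.
Proof.
have E : forall u v, sym_ext (sqdist p) u v =
    (p u 0 - p v 0) ^+ 2 + (p u 1 - p v 1) ^+ 2.
  apply: sym_ext_cases => [u' v'|u'|e].
  - by ring.
  - by ring.
  have -> : (1 : 'I_2) = lift ord0 ord0 by apply: val_inj.
  by rewrite /sqdist big_ord_recl big_ord1.
have G u' v' : gram (sqdist p) o u' v' =
    2%:R * ((p u' 0 - p o 0) * (p v' 0 - p o 0) + (p u' 1 - p o 1) * (p v' 1 - p o 1)).
  by rewrite /gram !E; ring.
(* The determinant of p_a - p_o and p_u' - p_o; the matrix [minor2] is 4 times the rank one matrix
   c_u c_v. *)
pose c u' := (p a 0 - p o 0) * (p u' 1 - p o 1) - (p a 1 - p o 1) * (p u' 0 - p o 0).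
have M u' v' : minor2 (sqdist p) o a u' v' = 4%:R * (c u' * c v').
  by rewrite /minor2 !G /c; ring.
by rewrite /rank_defect !M; ring.
Qed.

(** The rank defect of the generic vector of variables is itself a polynomial of the ideal, and
    evaluating it commutes with forming the defect. *)
Lemma CM_rank_defect n (x : pair n -> laurent) :
  (forall f, CM_ideal n 2 f ->
     mmap laurent_const (fun i => x (enum_val i)) f = 0) ->
  forall o a k u v, rank_defect x o a k u v = 0.
Proof.
move=> Ix o a k u v.
pose X (e : pair n) : mpoly #|{: pair n}| CC := mpolyX _ (mnm1 (enum_rank e)).
have HX (K : comNzRingType) (phi : {rmorphism CC -> K}) (z : pair n -> K) :
    mmap phi (fun i => z (enum_val i)) (rank_defect X o a k u v) =
    rank_defect z o a k u v.
  rewrite rank_defect_morph; apply: eq_rank_defect => e /=.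
  by rewrite /X mmapX mmap1U enum_rankK.
rewrite -(HX _ laurent_const); apply: Ix => p.
rewrite /meval (HX _ idfun (fun e => Complex (sqdist p e) 0)).
rewrite (@eq_rank_defect _ _ _ (real_complex Rdefinitions.R \o sqdist p)) //.
by rewrite -rank_defect_morph rank_defect_sqdist rmorph0.
Qed.

(** Completing the square twice: first with pivot [G a a], which is twice the nonzero entry at [o],
    [a], then with a pivot [H k k] if there is one. The factors 2 come from recovering distances
    from [G]. *)
Lemma gram_diagonalize n (K : fieldType) (x : pair n -> K) (o a : 'I_n) :
  (2%:R : K) != 0 -> sym_ext x o a != 0 ->
  (forall k u v, rank_defect x o a k u v = 0) ->
  exists al be p q, al != 0 /\
    forall u v, sym_ext x u v = al * (p u - p v) ^+ 2 + be * (q u - q v) ^+ 2.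
Proof.
move=> t0 xoa rk; set G := gram x o; set H := minor2 x o a.
have Gaa : G a a != 0.
  by rewrite /G /gram sym_ext_diag subr0 -mulr2n -mulr_natl mulf_neq0.
have GH u v : G u v = (H u v + G u a * G v a) / G a a.
  by rewrite /H /minor2 -/G subrK [G a a * _]mulrC mulfK.
have xG u v : sym_ext x u v = (G u u + G v v - 2%:R * G u v) / 2%:R.
  by rewrite /G /gram !sym_ext_diag; field.
have [[k Hkk]|Hno] := pselect (exists k, H k k != 0).
  have HE u v : H u v = H u k * H v k / H k k.
    have /eqP := rk k u v; rewrite /rank_defect -/H subr_eq0 => /eqP <-.
    by rewrite [H k k * _]mulrC mulfK.
  exists (2%:R * G a a)^-1, (2%:R * G a a * H k k)^-1, (fun u => G u a), (fun u => H u k).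
  split=> [|u v]; first by rewrite invr_eq0 mulf_neq0.
  rewrite xG (GH u u) (GH v v) (GH u v) (HE u u) (HE v v) (HE u v); move: Hkk Gaa t0.
  move: (H k k) (G a a) (H u k) (H v k) (G u a) (G v a) => h g x1 x2 y1 y2 h0 g0 t0.
  by field; rewrite h0 g0.
(* When the diagonal of [H] vanishes, the defect at v, u, u reduces to minus the square of [H u v];
   one square then suffices and [be] is 0. *)
have H0 u v : H u v = 0.
  have H00 k : H k k = 0 by apply/eqP/negPn/negP => Hk; apply: Hno; exists k.
  have /eqP := rk v u u; rewrite /rank_defect -/H !H00 mul0r sub0r oppr_eq0.
  by rewrite mulf_eq0 orbb => /eqP.
exists (2%:R * G a a)^-1, 0, (fun u => G u a), (fun=> 0).
split=> [|u v]; first by rewrite invr_eq0 mulf_neq0.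
rewrite xG (GH u u) (GH v v) (GH u v) !H0; move: Gaa t0.
by move: (G a a) (G u a) (G v a) => g y1 y2 g0 t0; field; rewrite g0.
Qed.

(** * Clades are laminar *)

Definition laminar (T : finType) (L : {set {set T}}) : Prop :=
  forall A B, A \in L -> B \in L -> [|| A \subset B, B \subset A | [disjoint A & B]].

Section Clades.

(** Trees are nested in lists, so the induction is mutual: [Q] is the companion statement on
    forests. *)
Lemma rtree_forest_ind (P : rtree -> Prop) (Q : seq rtree -> Prop) :
  (forall i, P (Leaf i)) -> (forall ts, Q ts -> P (Node ts)) ->
  Q [::] -> (forall t ts, P t -> Q ts -> Q (t :: ts)) -> forall t, P t.
Proof.
move=> Pleaf Pnode Qnil Qcons; fix IH 1 => -[//|ts]; apply: Pnode.
by elim: ts => // t ts; apply: Qcons.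
Qed.

Lemma wf_tree_leaves t : wf_tree t -> (0 < size (leaves t))%N.
Proof.
move: t; apply: (rtree_forest_ind
  (Q := fun ts => all wf_tree ts -> (size ts <= size (flatten (map leaves ts)))%N)).
- by [].
- by move=> ts IH /= /andP[ts2 /IH]; apply: leq_trans; apply: ltnW.
- by [].
move=> t ts IHt IHts /= /andP[/IHt t1 /IHts ts1].
by rewrite size_cat; lia.
Qed.

Lemma clades_seq_sub t c : c \in clades_seq t -> {subset c <= leaves t}.
Proof.
move: t c; apply: (rtree_forest_ind (Q := fun ts => forall c,
  c \in flatten (map clades_seq ts) -> {subset c <= flatten (map leaves ts)})) => //=.
- by move=> ts IH c; rewrite inE => /predU1P[->|/IH].
move=> t ts IHt IHts c; rewrite mem_cat => /orP[/IHt|/IHts] cs x /cs xc;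
  by rewrite mem_cat xc ?orbT.
Qed.

Lemma clades_seq_size t c : wf_tree t -> uniq (leaves t) ->
  c \in clades_seq t -> uniq c /\ (2 <= size c)%N.
Proof.
move: t c; apply: (rtree_forest_ind (Q := fun ts => forall c,
  all wf_tree ts -> uniq (flatten (map leaves ts)) ->
  c \in flatten (map clades_seq ts) -> uniq c /\ (2 <= size c)%N)) => //=.
- move=> ts IH c /andP[ts2 wfts] uts; rewrite inE => /predU1P[->|]; last exact: IH.
  split=> //; apply: leq_trans ts2 _.
  elim: ts wfts {IH uts} => //= t ts IH /andP[/wf_tree_leaves t1 /IH].
  by rewrite size_cat; lia.
move=> t ts IHt IHts c /andP[wt wts]; rewrite cat_uniq => /and3P[ut _ uts].
by rewrite mem_cat => /orP[/IHt|/IHts]; apply.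
Qed.

(** Clades from different children are disjoint because no leaf is repeated; inside one child the
    induction applies, and the root clade contains all others. *)
Lemma clades_seq_laminar t c d : uniq (leaves t) ->
  c \in clades_seq t -> d \in clades_seq t ->
  [\/ {subset c <= d}, {subset d <= c} | forall x, x \in c -> x \notin d].
Proof.
move: t c d; apply: (rtree_forest_ind (Q := fun ts => forall c d,
  uniq (flatten (map leaves ts)) -> c \in flatten (map clades_seq ts) ->
  d \in flatten (map clades_seq ts) ->
  [\/ {subset c <= d}, {subset d <= c} | forall x, x \in c -> x \notin d])) => //=.
- move=> ts IH c d uts ct dt.
  have sub e : e \in clades_seq (Node ts) -> {subset e <= flatten (map leaves ts)}.
    exact: clades_seq_sub.
  have [cs ds] := (sub _ ct, sub _ dt).
  move: ct dt; rewrite !inE => /predU1P[cE|ct]; first by constructor 2; rewrite cE.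
  by move=> /predU1P[dE|dt]; [constructor 1; rewrite dE | exact: IH].
move=> t ts IHt IHts c d; rewrite cat_uniq => /and3P[ut /hasPn dis uts].
have subs e : e \in flatten (map clades_seq ts) -> {subset e <= flatten (map leaves ts)}.
  move=> ets; have : e \in clades_seq (Node ts) by rewrite /= inE ets orbT.
  exact: clades_seq_sub.
rewrite !mem_cat => /orP[ct|cts] /orP[dt|dts].
- exact: IHt.
- constructor 3 => x xc; apply/negP => /(subs _ dts)/dis.
  by rewrite (clades_seq_sub ct xc).
- constructor 3 => x xc; have := dis _ (subs _ cts _ xc).
  by apply: contra; apply: clades_seq_sub.
- exact: IHts.
Qed.

Variables (n : nat) (t : rtree).
Hypothesis nt : rooted_tree n t.

Let wt : wf_tree t. Proof. by case/andP: nt. Qed.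
Let ut : uniq (leaves t).
Proof. by case/andP: nt => _ /perm_uniq ->; apply: iota_uniq. Qed.
Let leaves_lt i : i \in leaves t -> (i < n)%N.
Proof. by case/andP: nt => _ /perm_mem ->; rewrite mem_iota. Qed.

Lemma cladeP A : reflect
  (exists2 c, c \in clades_seq t & A = [set i : 'I_n | val i \in c]) (A \in clade n t).
Proof. by rewrite inE; apply: (iffP mapP). Qed.

Lemma clade_laminar : laminar (clade n t).
Proof.
move=> _ _ /cladeP[c ct ->] /cladeP[d dt ->].
case: (clades_seq_laminar ut ct dt) => [cd|dc|dis].
- by apply/or3P; constructor 1; apply/subsetP => i; rewrite !inE => /cd.
- by apply/or3P; constructor 2; apply/subsetP => i; rewrite !inE => /dc.
apply/or3P; constructor 3; rewrite disjoint_subset; apply/subsetP => i.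
by rewrite !inE => /dis.
Qed.

Lemma clade_card A : A \in clade n t -> (1 < #|A|)%N.
Proof.
move=> /cladeP[c ct ->]; have [] := clades_seq_size wt ut ct.
have sub := clades_seq_sub ct.
case: c ct sub => [|x [|y c]] //= ct sub; rewrite inE negb_or -andbA => /and3P[xy _ _] _.
have xn : (x < n)%N by apply/leaves_lt/sub; rewrite inE eqxx.
have yn : (y < n)%N by apply/leaves_lt/sub; rewrite !inE eqxx orbT.
apply/card_gt1P; exists (Ordinal xn), (Ordinal yn).
by rewrite !inE /= !eqxx orbT.
Qed.

End Clades.

Definition bilaminar (T : finType) (F : {set {set T}}) : Prop :=
  exists L1 L2, [/\ laminar L1, laminar L2 & F \subset L1 :|: L2].

Lemma TP_face_bilaminar n (F : {set {set 'I_n}}) : TP_face F ->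
  bilaminar F /\ forall A, A \in F -> (1 < #|A|)%N.
Proof.
move=> [t1 [t2 [nt1 nt2 /subsetP sF]]]; split.
  exists (clade n t1), (clade n t2); split; try exact: clade_laminar.
  exact/subsetP.
by move=> A /sF; rewrite inE => /orP[]; apply: clade_card.
Qed.

Lemma TP_face_sub n (F G : {set {set 'I_n}}) : F \subset G -> TP_face G -> TP_face F.
Proof.
by move=> FG [t1 [t2 [nt1 nt2 sG]]]; exists t1, t2; split=> //; apply: subset_trans sG.
Qed.

(** * Coordinates in the cones *)

Section UpSum.
Variable T : finType.
Implicit Types (A B S : {set T}) (c : {set T} -> RR).

(** At a pair this is minus the coordinate of the point with coefficients [c], a ray being minus the
    indicator of the pairs inside its clade. *)
Definition upsum c S : RR := \sum_(A : {set T} | S \subset A) c A.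

Lemma upsum_split c S S' : S' \subset S ->
  upsum c S' = upsum c S + \sum_(A : {set T} | (S' \subset A) && ~~ (S \subset A)) c A.
Proof.
move=> S'S; rewrite /upsum (bigID (fun A : {set T} => S \subset A)) /=; congr (_ + _).
by apply: eq_bigl => A; apply: andb_idl; apply: subset_trans.
Qed.

Lemma upsum_le c S S' : (forall A, A != setT -> 0 <= c A) -> S' \subset S ->
  upsum c S <= upsum c S'.
Proof.
move=> c0 /upsum_split->; rewrite lerDl sumr_ge0 // => A /andP[_ nSA].
by apply: c0; apply: contraNneq nSA => ->; apply: subsetT.
Qed.

Lemma laminar_cross L A B (x y z : T) : laminar L -> A \in L -> B \in L ->
  x \in A -> x \notin B -> y \in B -> y \notin A -> z \in A -> z \in B -> False.
Proof.
move=> lamL AL BL xA xB yB yA zA zB; case/or3P: (lamL A B AL BL).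
- by move=> /subsetP/(_ x xA); rewrite (negPf xB).
- by move=> /subsetP/(_ y yB); rewrite (negPf yA).
- by rewrite disjoint_subset => /subsetP/(_ z zA); rewrite inE zB.
Qed.

Lemma upsum_drop F c S : bilaminar F ->
  (forall A, A != setT -> A \notin F -> c A = 0) -> (2 < #|S|)%N ->
  exists2 x, x \in S & upsum c (S :\ x) = upsum c S.
Proof.
move=> [L1 [L2 [lam1 lam2 /subsetP sF]]] c0 S3; apply: contrapT => nex.
(* If removing [x] changes the sum, some supporting set contains the rest of [S] but not [x]. *)
have crit x : x \in S ->
    exists A, [/\ A \in L1 :|: L2, S :\ x \subset A & x \notin A].
  move=> xS; apply: contrapT => nA; apply: nex; exists x => //.
  rewrite (upsum_split c (subsetDl S [set x])) big1 ?addr0 // => A /andP[SxA nSA].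
  apply: c0; first by apply: contraNneq nSA => ->; apply: subsetT.
  apply/negP => AF; apply: nA; exists A; split=> //; first exact: sF.
  apply: contra nSA => xA; apply/subsetP => y yS.
  have [->//|yx] := eqVneq y x.
  by apply: (subsetP SxA); rewrite !inE yx.
have cross L A B x y z : laminar L -> A \in L -> B \in L ->
    x \in S -> y \in S -> z \in S -> x != y -> y != z -> z != x ->
    S :\ x \subset A -> x \notin A -> S :\ y \subset B -> y \notin B -> False.
  move=> lamL AL BL xS yS zS xy yz zx /subsetP SA xA /subsetP SB yB.
  apply: (laminar_cross (x := y) (y := x) (z := z) lamL AL BL) => //.
  - by apply: SA; rewrite !inE eq_sym xy.
  - by apply: SB; rewrite !inE xy.
  - by apply: SA; rewrite !inE zx.
  - by apply: SB; rewrite !inE eq_sym yz.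
(* Three points and two families: two of the three sets lie in one family. Each contains the point
   the other omits, and both contain the third point, against laminarity. *)
have /card_gt2P[x [y [z [[xS yS zS] [xy yz zx]]]]] := S3.
have [[A [AL SA xA]] [B [BL SB yB]] [C [CL SC zC]]] := And3 (crit x xS) (crit y yS) (crit z zS).
have cxy L := cross L A B x y z.
have cyz L := cross L B C y z x.
have czx L := cross L C A z x y.
move: AL BL CL; rewrite !inE.
by move=> /orP[AL|AL] /orP[BL|BL] /orP[CL|CL];
  solve [by apply: (cxy L1) | by apply: (cxy L2) | by apply: (cyz L1)
        | by apply: (cyz L2) | by apply: (czx L1) | by apply: (czx L2)].
Qed.

Lemma upsum_pair F c S : bilaminar F ->
  (forall A, A != setT -> A \notin F -> c A = 0) -> (1 < #|S|)%N ->
  exists u v, [/\ u \in S, v \in S, u != v & upsum c S = upsum c [set u; v]].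
Proof.
move=> bF c0; have [k] := ubnP #|S|; elim: k S => // k IH S Sk S2.
have [S3|S3] := ltnP 2 #|S|.
  have [x xS <-] := upsum_drop bF c0 S3.
  have cS := cardsD1 x S; rewrite xS in cS.
  have [||u [v [uS vS uv ->]]] := IH (S :\ x); [by lia | by lia |].
  exists u, v; split=> //; [move: uS | move: vS]; by rewrite inE => /andP[].
have /cards2P[u [v [uv SE]]] : #|S| == 2%N by rewrite eqn_leq S3.
by exists u, v; rewrite SE !inE !eqxx orbT.
Qed.

(** Möbius inversion, by descending induction from the full set. The weights do not depend on [c],
    which yields continuity, and they live on supersets of [A], so a set with at least two elements
    only involves such sets. *)
Lemma upsum_inversion A : exists m : {set T} -> RR,
  (forall S, ~~ (A \subset S) -> m S = 0) /\
  forall c, c A = \sum_S m S * upsum c S.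
Proof.
have [k] := ubnP #|~: A|; elim: k A => // k IH A Ak.
(* The inclusion sits inside the existential so that [choice] gives a total family of weights. *)
have : forall B, exists m : {set T} -> RR, A \proper B ->
    (forall S, ~~ (B \subset S) -> m S = 0) /\
    forall c, c B = \sum_S m S * upsum c S.
  move=> B; have [AB|nAB] := boolP (A \proper B); last by exists (fun=> 0).
  have [|m mP] := IH B; last by exists m.
  by have := proper_card AB; have := cardsC A; have := cardsC B; lia.
move=> /choice[m mP].
exists (fun S => (S == A)%:R - \sum_(B : {set T} | A \proper B) m B S); split=> [S nAS|c].
  rewrite (_ : S == A = false); last by apply: contraNF nAS => /eqP->.
  rewrite big1 ?subr0 // => B AB; apply: (mP B AB).1.
  by apply: contra nAS; apply: subset_trans; apply: proper_sub.
transitivity (upsum c A - \sum_(B : {set T} | A \proper B) c B).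
  rewrite /upsum (bigD1 A) //= addrC (eq_bigl (fun B : {set T} => A \proper B)).
    by rewrite addrC addrK.
  by move=> B; rewrite properEneq andbC eq_sym.
under [RHS]eq_bigr do rewrite mulrBl.
rewrite big_split /=; congr (_ + _).
  rewrite (bigD1 A) //= eqxx mul1r big1 ?addr0 // => S /negPf->.
  by rewrite mul0r.
rewrite sumrN; congr (- _); under [RHS]eq_bigr do rewrite mulr_suml.
by rewrite exchange_big /=; apply: eq_bigr => B AB; rewrite (mP B AB).2.
Qed.

End UpSum.

(** * Uniqueness of coordinates and closedness of the support *)

Section Cones.
Variable n : nat.
Implicit Types (A B S : {set 'I_n}) (F G : {set {set 'I_n}}) (e : pair n).
Implicit Types (c lam : {set 'I_n} -> RR) (w : pair n -> RR).

Definition pset e : {set 'I_n} := [set (val e).1; (val e).2].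

Lemma card_pset e : #|pset e| = 2%N.
Proof. by rewrite cards2 -val_eqE /= ltn_eqF // (valP e). Qed.

Lemma pset_ex (u v : 'I_n) : u != v -> exists e, pset e = [set u; v].
Proof.
wlog uv : u v / (u < v)%N => [H nuv|_].
  have [|vu|/val_inj E] := ltngtP u v; [by move=> /H; apply | | by rewrite E eqxx in nuv].
  by have [|e eE] := H v u vu; [rewrite eq_sym | exists e; rewrite setUC].
by exists (Sub (u, v) uv : pair n).
Qed.

Definition ray A e : RR := - (pset e \subset A)%:R.

(** [ray setT] is constantly -1, so the lineality term [mu] becomes the coefficient [- mu] of [setT]
    and a point is described by a single upward sum. *)
Definition cone_coef F lam (mu : RR) A : RR :=
  if A == setT then - mu else if A \in F then lam A else 0.

Lemma cone_coefE F lam mu e :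
  \sum_(A in F | A != setT) lam A * ray A e + mu =
  - upsum (cone_coef F lam mu) (pset e).
Proof.
rewrite /upsum [in RHS](bigD1 setT) ?subsetT //= opprD addrC; congr (_ + _).
  by rewrite /cone_coef eqxx opprK.
rewrite -sumrN big_mkcond [RHS]big_mkcond; apply: eq_bigr => A _.
rewrite /cone_coef /ray; case: eqP => _; rewrite ?andbF ?andbT //=.
by case: ifP => _; case: ifP => _; rewrite ?oppr0 ?mulr0 ?mulrN ?mulr1.
Qed.

(* The coefficient of setT carries the lineality space, so it has no sign. *)
Definition cone_coords F w c : Prop :=
  [/\ forall A, A != setT -> 0 <= c A,
      forall A, A != setT -> A \notin F -> c A = 0
    & forall e, w e = - upsum c (pset e)].

Lemma fan_cone_coords F w lam mu :
  (forall A, A \in F -> A != setT -> 0 <= lam A) ->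
  (forall e, w e = \sum_(A in F | A != setT) lam A * ray A e + mu) ->
  cone_coords F w (cone_coef F lam mu).
Proof.
move=> lam0 wE; split=> [A AT|A AT AF|e]; last by rewrite wE cone_coefE.
  by rewrite /cone_coef (negPf AT); case: ifP => // AF; apply: lam0.
by rewrite /cone_coef (negPf AT) (negPf AF).
Qed.

Lemma fan_coneP F w : fan_cone ray F w <-> exists c, cone_coords F w c.
Proof.
split=> [[lam [mu [lam0 wE]]]|[c [c0 cF wE]]].
  by exists (cone_coef F lam mu); apply: fan_cone_coords.
exists c, (- c setT); split=> [A _|e]; first exact: c0.
rewrite wE cone_coefE; congr (- _); apply: eq_bigr => A _.
rewrite /cone_coef opprK; case: eqP => [->//|/eqP AT].
by case: ifP => // /negbT AF; rewrite cF.
Qed.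

Definition min_on (g : pair n -> RR) S (x : RR) : Prop :=
  (forall e, pset e \subset S -> x <= g e) /\
  (exists2 e, pset e \subset S & x = g e).

Lemma min_on_ex g S : (1 < #|S|)%N -> exists x, min_on g S x.
Proof.
move=> /card_gt1P[u [v [uS vS /pset_ex[e0 e0E]]]].
have e0S : pset e0 \subset S by rewrite e0E subUset !sub1set uS.
have [e eS emin] := @Order.TotalTheory.arg_minP _ _ _ e0 (fun e => pset e \subset S) g e0S.
by exists (g e); split=> //; exists e.
Qed.

(** Minima are 1-Lipschitz for the sup norm. The case [eps = 0] gives uniqueness of coordinates,
    small [eps] gives closedness. *)
Lemma min_on_close (g g' : pair n -> RR) S (x x' eps : RR) :
  (forall e, `|g e - g' e| <= eps) ->
  min_on g S x -> min_on g' S x' -> `|x - x'| <= eps.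
Proof.
move=> gg' [xmin [e eS xE]] [x'min [e' e'S x'E]].
have := xmin e' e'S; have := x'min e eS.
have := gg' e; have := gg' e'; rewrite !ler_norml xE x'E => /andP[? ?] /andP[? ?] ? ?.
by apply/andP; split; lra.
Qed.

(** Nonnegativity of the coefficients makes upward sums monotone, hence the lower bound;
    bilaminarity makes some pair attain it. *)
Lemma cone_coords_min F w c S : TP_face F -> cone_coords F w c -> (1 < #|S|)%N ->
  min_on (fun e => - w e) S (upsum c S).
Proof.
move=> /TP_face_bilaminar[bF _] [c0 cF wE] S2; split=> [e eS|].
  by rewrite wE opprK upsum_le.
have [u [v [uS vS uv ->]]] := upsum_pair bF cF S2.
have [e eE] := pset_ex uv; exists e; last by rewrite wE opprK eE.
by rewrite eE subUset !sub1set uS.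
Qed.

Lemma cone_coords_small F w c A : (1 < n)%N -> TP_face F -> cone_coords F w c ->
  (#|A| <= 1)%N -> A != setT /\ c A = 0.
Proof.
move=> n2 /TP_face_bilaminar[_ F2] [_ cF _] A1.
have AT : A != setT.
  by apply: contraTneq A1 => ->; rewrite cardsT card_ord -ltnNge.
by split=> //; apply: cF => //; apply/negP => /F2; rewrite ltnNge A1.
Qed.

(** Inversion expresses each coefficient through minima of [- w], which do not refer to the face.
    Allowing two faces gives linear independence and the intersection property alike. *)
Lemma cone_coords_uniq F G w c c' : (1 < n)%N -> TP_face F -> TP_face G ->
  cone_coords F w c -> cone_coords G w c' -> forall A, c A = c' A.
Proof.
move=> n2 tF tG cw c'w A; have [A2|A1] := ltnP 1 #|A|; last first.
  by rewrite (cone_coords_small n2 tF cw A1).2 (cone_coords_small n2 tG c'w A1).2.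
have [m [m0 mE]] := upsum_inversion A; rewrite !mE; apply: eq_bigr => S _.
have [AS|/m0->] := boolP (A \subset S); last by rewrite !mul0r.
have S2 : (1 < #|S|)%N by apply: leq_trans A2 (subset_leq_card AS).
congr (_ * _); apply/eqP; rewrite -subr_eq0 -normr_le0.
apply: (min_on_close _ (cone_coords_min tF cw S2) (cone_coords_min tG c'w S2)) => e.
by rewrite subrr normr0.
Qed.

Lemma TP_cones_independent F lam mu : (1 < n)%N -> TP_face F ->
  (forall e, \sum_(A in F | A != setT) lam A * ray A e = mu) ->
  forall A, A \in F -> A != setT -> lam A = 0.
Proof.
move=> n2 tF sumE A AF AT.
(* Positive and negative parts turn a linear relation into two nonnegative representations of one
   point. *)
pose lp B := Num.max (lam B) 0; pose ln B := Num.max (- lam B) 0.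
have lamE B : lam B = lp B - ln B.
  by rewrite /lp /ln /Num.max; do 2![case: ltP => ?]; lra.
pose w e := \sum_(A in F | A != setT) lp A * ray A e + 0.
have wn e : w e = \sum_(A in F | A != setT) ln A * ray A e + mu.
  rewrite /w -(sumE e) addr0 -big_split /=; apply: eq_bigr => B _.
  by rewrite lamE; ring.
have lp0 B : B \in F -> B != setT -> 0 <= lp B by rewrite /lp le_max lexx orbT.
have ln0 B : B \in F -> B != setT -> 0 <= ln B by rewrite /ln le_max lexx orbT.
have := cone_coords_uniq n2 tF tF (fan_cone_coords lp0 (fun e => erefl (w e)))
  (fan_cone_coords ln0 wn) A.
by rewrite lamE /cone_coef (negPf AT) AF => ->; rewrite subrr.
Qed.

Lemma TP_cones_inter F G w : (1 < n)%N -> TP_face F -> TP_face G ->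
  fan_cone ray F w /\ fan_cone ray G w <-> fan_cone ray (F :&: G) w.
Proof.
move=> n2 tF tG; split=> [[/fan_coneP[c cw] /fan_coneP[c' c'w]]|].
  apply/fan_coneP; exists c; have cc' := cone_coords_uniq n2 tF tG cw c'w.
  case: cw c'w => c0 cF wE [_ c'G _]; split=> // A AT.
  rewrite inE negb_and => /orP[|AG]; first exact: cF.
  by rewrite cc' c'G.
move=> /fan_coneP[c [c0 cFG wE]].
by split; apply/fan_coneP; exists c; split=> // A AT nA;
  apply: cFG; rewrite // inE negb_and nA ?orbT.
Qed.

(** The limit coefficients are computed from the minima of [- w] by inversion. They are uniformly
    close to those of nearby cone points, so signs and representation pass to the limit; the support
    is a face because it lies in a nearby one. *)
Lemma TP_support_closed w : (1 < n)%N ->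
  (forall eps : RR, 0 < eps -> exists w' F,
     [/\ TP_face F, fan_cone ray F w' & forall e, `|w e - w' e| < eps]) ->
  exists F, TP_face F /\ fan_cone ray F w.
Proof.
move=> n2 close.
have /choice[M MP] := @upsum_inversion 'I_n.
have /choice[mu muP] : forall S, exists x, (1 < #|S|)%N -> min_on (fun e => - w e) S x.
  move=> S; have [S2|S1] := ltnP 1 #|S|; last by exists 0.
  by have [x xP] := min_on_ex (fun e => - w e) S2; exists x.
(* Sets with fewer than two elements are never clades. *)
pose c A := if (1 < #|A|)%N then \sum_S M A S * mu S else 0.
(* A common bound for the row sums of the inversion weights; the added 1 keeps it positive for the
   divisions below. *)
pose K : RR := 1 + \sum_A \sum_S `|M A S|.
have K1 A : \sum_S `|M A S| <= K.
  rewrite /K [in leRHS](bigD1 A) //= addrCA lerDl addr_ge0 // sumr_ge0 // => B _.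
  exact: sumr_ge0.
have K0 : 0 < K.
  by rewrite ltr_pwDl // sumr_ge0 // => B _; exact: sumr_ge0.
have approx eps : 0 < eps -> exists w' F c',
    [/\ TP_face F, cone_coords F w' c', forall e, `|w e - w' e| < eps
      & forall A, `|c A - c' A| <= K * eps].
  move=> eps0; have [w' [F [tF /fan_coneP[c' cw'] ww']]] := close eps eps0.
  exists w', F, c'; split=> // A; rewrite /c; case: ltnP => [A2|A1]; last first.
    by rewrite (cone_coords_small n2 tF cw' A1).2 subrr normr0 mulr_ge0 // ltW.
  rewrite (MP A).2 -sumrB; apply: le_trans (ler_norm_sum _ _ _) _.
  apply: le_trans (ler_wpM2r (ltW eps0) (K1 A)); rewrite mulr_suml.
  apply: ler_sum => S _; rewrite -mulrBr.
  have [AS|/(MP A).1->] := boolP (A \subset S); last by rewrite mul0r normr0 mul0r.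
  have S2 : (1 < #|S|)%N by apply: leq_trans A2 (subset_leq_card AS).
  rewrite normrM ler_wpM2l //.
  apply: (min_on_close _ (muP S S2) (cone_coords_min tF cw' S2)) => e.
  by rewrite opprK addrC distrC ltW.
have c0 A : A != setT -> 0 <= c A.
  move=> AT; rewrite -oppr_le0; apply/ler_addgt0Pr => e e0; rewrite add0r.
  have [w' [F [c' [tF [c'0 _ _] _ /(_ A)]]]] := approx _ (divr_gt0 e0 K0).
  rewrite mulrCA divff ?gt_eqF // mulr1 ler_norml => /andP[le_e _].
  by have := c'0 A AT; move: le_e; lra.
have [F [tF FP]] : exists F, TP_face F /\ forall A, A != setT -> A \notin F -> c A = 0.
  pose F := [set A | (A != setT) && (0 < c A)].
  (* A positive lower bound of [c] on [F], the initial 1 covering an empty [F]. Coefficients within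
     d / 2 of [c] are nonzero on [F], so the nearby face contains [F]. *)
  pose d := \big[Num.min/1]_(A in F) c A.
  have d0 : 0 < d by apply: lt_bigmin => // A; rewrite inE => /andP[].
  have d20 : 0 < d / 2 by rewrite divr_gt0.
  have [w' [F' [c' [tF' [_ c'F _] _ cc']]]] := approx _ (divr_gt0 d20 K0).
  exists F; split=> [|A AT]; last first.
    by rewrite inE AT /= -leNgt => cA; apply: le_anti; rewrite cA c0.
  apply: TP_face_sub tF'; apply/subsetP => A AF; apply/negPn/negP => AF'.
  have AT : A != setT by move: AF; rewrite inE => /andP[].
  have dA : d <= c A by apply: bigmin_le_cond.
  have := cc' A; rewrite (c'F A AT AF') subr0 mulrCA divff ?gt_eqF // mulr1.
  by rewrite ler_norml => /andP[_]; lra.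
exists F; split=> //; apply/fan_coneP; exists c; split=> // e.
apply/eqP; rewrite -subr_eq0 opprK -normr_le0; apply/ler_addgt0Pr => d d0; rewrite add0r.
(* The tolerance [d] is shared: d / N for the distance from [w] to [w'], and K d / N for each
   set. *)
pose N : RR := 1 + \sum_(A : {set 'I_n}) K.
have N0 : 0 < N by rewrite ltr_pwDl // sumr_ge0 // => A _; exact: ltW.
have [w' [F' [c' [_ [_ _ w'E] ww' cc']]]] := approx _ (divr_gt0 d0 N0).
have -> : w e + upsum c (pset e) =
    (w e - w' e) + (upsum c (pset e) - upsum c' (pset e)) by rewrite w'E; ring.
apply: le_trans (ler_normD _ _) _.
have -> : d = d / N + \sum_(A : {set 'I_n}) K * (d / N).
  by rewrite -mulr_suml -[X in X + _]mul1r -mulrDl -/N mulrCA divff ?mulr1 // gt_eqF.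
apply: lerD; first exact: ltW.
rewrite /upsum -sumrB; apply: le_trans (ler_norm_sum _ _ _) _.
rewrite [leRHS](bigID (fun A : {set 'I_n} => pset e \subset A)) /=.
rewrite -[leLHS]addr0; apply: lerD; first exact: ler_sum.
by apply: sumr_ge0 => A _; rewrite mulr_ge0 ?divr_ge0 // ltW.
Qed.

End Cones.

(** * Trees from ultrametrics *)

Section UltrametricTree.
Variable n : nat.
Implicit Types (A S : {set 'I_n}) (F G : {set {set 'I_n}}) (w : pair n -> RR).

Lemma eq_fan_cone F w w' : w =1 w' -> fan_cone (@ray n) F w -> fan_cone (@ray n) F w'.
Proof. by move=> /funext->. Qed.

Lemma fan_cone0 F : fan_cone (@ray n) F (fun=> 0).
Proof.
apply/fan_coneP; exists (fun=> 0); split=> // e.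
by rewrite /upsum big1 ?oppr0.
Qed.

Lemma fan_coneD F G w w' : fan_cone (@ray n) F w -> fan_cone (@ray n) G w' ->
  fan_cone (@ray n) (F :|: G) (fun e => w e + w' e).
Proof.
move=> /fan_coneP[c [c0 cF wE]] /fan_coneP[c' [c'0 c'G w'E]].
apply/fan_coneP; exists (fun A => c A + c' A); split=> [A AT|A AT|e].
- by rewrite addr_ge0 ?c0 ?c'0.
- by rewrite inE negb_or => /andP[AF AG]; rewrite cF ?c'G ?addr0.
by rewrite wE w'E /upsum big_split opprD.
Qed.

Lemma fan_cone_ray A (a : RR) : 0 <= a ->
  fan_cone (@ray n) [set A] (fun e => a * ray A e).
Proof.
move=> a0; apply/fan_coneP; exists (fun B => if B == A then a else 0).
split=> [B _|B _|e]; [by case: ifP | by rewrite inE => /negPf-> |].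
rewrite /upsum -big_mkcondr /ray; case: (boolP (pset e \subset A)) => [eA|neA].
  rewrite (eq_bigl (pred1 A)) ?big_pred1_eq ?mulrN ?mulr1 // => B /=.
  by rewrite andb_idl // => /eqP->.
rewrite big_pred0 ?oppr0 ?mulr0 // => B.
by apply/negP => /andP[eB /eqP BA]; rewrite -BA eB in neA.
Qed.

Lemma fan_cone_const F (k : RR) : fan_cone (@ray n) F (fun=> k).
Proof.
apply/fan_coneP; exists (fun B => if B == setT then - k else 0).
split=> [A /negPf->|A /negPf->|e] //.
rewrite /upsum -big_mkcondr (eq_bigl (pred1 setT)) ?big_pred1_eq ?opprK // => B /=.
by rewrite andb_idl // => /eqP->; apply: subsetT.
Qed.

Variable D : 'I_n -> 'I_n -> RR.
Hypothesis Dultra : ultrametric D.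

Let height (e : pair n) : RR := D (val e).1 (val e).2.

(* It suffices to split off one class of the relation [m < D u v], m being the
   minimum of D on S, so binary trees are enough. *)
Lemma ultrametric_split S : (1 < #|S|)%N -> exists (m : RR) S1 S2,
  [/\ S1 :|: S2 = S, [disjoint S1 & S2], S1 != set0, S2 != set0
    & (forall u v, u \in S -> v \in S -> u != v -> m <= D u v) /\
      (forall u v, u \in S1 -> v \in S2 -> D u v = m)].
Proof.
have [Dsym Dult] := Dultra.
move=> S2; have [m [mmin [e0 e0S mE]]] := min_on_ex height S2.
have Dmin u v : u \in S -> v \in S -> u != v -> m <= D u v.
  move=> uS vS uv; have [e eE] := pset_ex uv.
  have : m <= height e by apply: mmin; rewrite eE subUset !sub1set uS.
  have e12 : (val e).1 != (val e).2 by rewrite -val_eqE /= ltn_eqF // (valP e).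
  have : u \in pset e by rewrite eE !inE eqxx.
  have : v \in pset e by rewrite eE !inE eqxx orbT.
  rewrite /height !inE => /orP[]/eqP vE /orP[]/eqP uE; rewrite uE vE //.
  - by rewrite uE vE eqxx in uv.
  - by rewrite Dsym.
  - by rewrite uE vE eqxx in uv.
pose u0 := (val e0).1; pose v0 := (val e0).2.
have u0v0 : u0 != v0 by rewrite -val_eqE /= ltn_eqF // (valP e0).
have [u0S v0S] : u0 \in S /\ v0 \in S.
  by move: e0S; rewrite subUset !sub1set => /andP.
pose P v := (v == u0) || (m < D u0 v).
exists m, [set v in S | P v], [set v in S | ~~ P v]; split.
- by apply/setP => v; rewrite !inE -andb_orr orbN andbT.
- rewrite disjoint_subset; apply/subsetP => v; rewrite !inE => /andP[_ ->].
  by rewrite andbF.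
- by apply/set0Pn; exists u0; rewrite inE u0S /P eqxx.
- apply/set0Pn; exists v0; rewrite inE v0S /P negb_or eq_sym u0v0 /=.
  by rewrite -leNgt mE.
split=> // u v; rewrite !inE => /andP[uS Pu] /andP[vS]; rewrite negb_or -leNgt.
move=> /andP[vu0 Dv]; have u0v : u0 != v by rewrite eq_sym.
have Duv0 : D u0 v = m by apply: le_anti; rewrite Dv Dmin.
move: Pu; rewrite /P; have [->//|uu0 /= Du] := eqVneq u u0.
have uv : u != v by apply: contraTneq Du => ->; rewrite -leNgt.
apply: le_anti; rewrite Dmin // andbT leNgt; apply/negP => Duv.
have := Dult u0 u v; rewrite eq_sym uu0 uv u0v => /(_ isT isT isT).
by rewrite Duv0 leNgt lt_min Du Duv.
Qed.

(** [m0] plays the height of the parent. The clade [S] gets coefficient m - m0, with m the minimum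
    of [D] on [S], and both halves continue from m; a pair split at [S] has height exactly m. *)
Lemma ultrametric_subtree S (m0 : RR) : S != set0 ->
  (forall u v, u \in S -> v \in S -> u != v -> m0 <= D u v) ->
  exists t, [/\ wf_tree t, perm_eq (leaves t) [seq val i | i <- enum S]
    & fan_cone (@ray n) (clade n t)
        (fun e => if pset e \subset S then m0 - height e else 0)].
Proof.
have [k] := ubnP #|S|; elim: k S m0 => // k IH S m0 Sk S0 Dm0.
have [S2|S1] := ltnP 1 #|S|; last first.
  have /cards1P[u SE] : #|S| == 1%N by rewrite eqn_leq S1 card_gt0.
  exists (Leaf (val u)); split=> //; first by rewrite SE enum_set1.
  apply: eq_fan_cone (fan_cone0 _) => e; case: ifP => // /subset_leq_card.
  by rewrite card_pset SE cards1.
have [m [A [B [ABS dAB A0 B0 [Dmin Dm]]]]] := ultrametric_split S2.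
have [AS BS] : A \subset S /\ B \subset S by rewrite -ABS subsetUl subsetUr.
have cAB : #|S| = (#|A| + #|B|)%N.
  by rewrite -ABS cardsU (disjoint_setI0 dAB) cards0 subn0.
have [cA cB] : (0 < #|A|)%N /\ (0 < #|B|)%N by rewrite !card_gt0.
have [|||tA [wA pA fA]] := IH A m => //; first by lia.
  by move=> u v uA vA; apply: Dmin; apply: (subsetP AS).
have [|||tB [wB pB fB]] := IH B m => //; first by lia.
  by move=> u v uB vB; apply: Dmin; apply: (subsetP BS).
have pS : perm_eq (leaves tA ++ leaves tB) [seq val i | i <- enum S].
  have : perm_eq (enum A ++ enum B) (enum S).
    apply: uniq_perm; rewrite ?enum_uniq ?cat_uniq ?enum_uniq //=.
      rewrite andbT; apply/hasPn => i; rewrite !mem_enum => iB.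
      by apply/negP => iA; have := disjointFr dAB iA; rewrite iB.
    by move=> i; rewrite mem_cat !mem_enum -ABS inE.
  move=> /(perm_map val); rewrite map_cat; apply: perm_trans.
  exact: perm_cat.
have [u [v [uS vS uv]]] := card_gt1P S2.
have m0m : 0 <= m - m0.
  have [/set0Pn[a aA] /set0Pn[b bB]] := (A0, B0).
  rewrite subr_ge0 -(Dm a b aA bB) Dm0 ?(subsetP AS a) ?(subsetP BS b) //.
  by apply: contraTneq bB => <-; rewrite (disjointFr dAB aA).
exists (Node [:: tA; tB]); split; first by rewrite /= wA wB.
  by rewrite /= cats0.
have cE : clade n (Node [:: tA; tB]) = [set S] :|: clade n tA :|: clade n tB.
  apply/setP => X; rewrite /clade; have -> : clades_seq (Node [:: tA; tB]) =
    (leaves tA ++ leaves tB) :: clades_seq tA ++ clades_seq tB by rewrite /= !cats0.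
  rewrite map_cons map_cat !inE mem_cat -orbA.
  congr (_ || _); congr (_ == _); apply/setP => i.
  by rewrite inE (perm_mem pS) (mem_map val_inj) mem_enum.
rewrite cE; have := fan_coneD (fan_coneD (fan_cone_ray S m0m) fA) fB.
apply: eq_fan_cone => e; rewrite /ray.
have [eS|neS] := boolP (pset e \subset S); last first.
  have nsub (C : {set _}) : C \subset S -> pset e \subset C = false.
    by move=> CS; apply: contraNF neS => eC; exact: subset_trans eC CS.
  by rewrite !nsub // oppr0 mulr0 !addr0.
have sub (C : {set _}) : (pset e \subset C) = ((val e).1 \in C) && ((val e).2 \in C).
  by rewrite subUset !sub1set.
have [e1S e2S] : (val e).1 \in S /\ (val e).2 \in S by apply/andP; rewrite -sub.
have mem i : i \in S -> (i \in B) = (i \notin A).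
  rewrite -ABS inE; have [iA|iA] := boolP (i \in A); last by [].
  by rewrite (disjointFr dAB iA).
rewrite !sub !mem // /height.
have [e1A|e1A] := boolP ((val e).1 \in A); have [e2A|e2A] := boolP ((val e).2 \in A) => /=.
- by ring.
- by rewrite (Dm _ _ e1A) ?mem //; ring.
- by rewrite Dultra.1 (Dm _ _ e2A) ?mem //; ring.
- by ring.
Qed.

Lemma ultrametric_tree : (0 < n)%N ->
  exists2 t, rooted_tree n t & fan_cone (@ray n) (clade n t) (fun e => - height e).
Proof.
(* Any lower bound of [D] off the diagonal would do; the constant is absorbed by the lineality
   space. *)
move=> n0; pose m0 : RR := - \sum_(u < n) \sum_(v < n) `|D u v|.
have [||t [wt pt ft]] := @ultrametric_subtree setT m0.
- by rewrite -card_gt0 cardsT card_ord.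
- move=> u v _ _ _; rewrite lerNl; apply: le_trans (ler_norm _) _; rewrite normrN.
  rewrite (bigD1 u) //= (bigD1 v) //= -addrA lerDl addr_ge0 ?sumr_ge0 // => i _.
  exact: sumr_ge0.
exists t.
  rewrite /rooted_tree wt -val_enum_ord /=; move: pt.
  by rewrite (eq_enum (in_setT (T := _))).
have := fan_coneD ft (fan_cone_const (clade n t) (- m0)); rewrite setUid.
by apply: eq_fan_cone => e; rewrite subsetT; ring.
Qed.

End UltrametricTree.

(** * Tropical points and cones *)

Lemma sym_ext_neq n (A : zmodType) (y : pair n -> A) u v :
  u != v -> exists e, sym_ext y u v = y e.
Proof.
move=> uv; rewrite /sym_ext; case: insubP => [e _ _|]; first by exists e.
case: insubP => [e _ _ _|]; first by exists e.
rewrite /= -!leqNgt => vu uv'; suff E : u = v by rewrite E eqxx in uv.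
by apply: val_inj; apply/eqP; rewrite eqn_leq vu.
Qed.

Lemma ultrametric_scale n (D : 'I_n -> 'I_n -> RR) (a : RR) : 0 <= a ->
  ultrametric D -> ultrametric (fun u v => a * D u v).
Proof.
move=> a0 [Dsym Dult]; split=> [u v|u v w uv vw uw]; first by rewrite Dsym.
have := Dult u v w uv vw uw; rewrite !ge_min.
by move=> /orP[H|H]; apply/orP; [left | right]; apply: ler_wpM2l.
Qed.

Lemma trop_val_pts_cone n (w : pair n -> RR) : (1 < n)%N ->
  trop_val_pts (CM_ideal n 2) w -> exists F, TP_face F /\ fan_cone (@ray n) F w.
Proof.
move=> n2 [N [x [N0 Ix xw]]].
have x0 e : x e != 0 by have [r [/laurent_ord_neq0]] := xw e.
have s0 u v : u != v -> sym_ext x u v != 0.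
  by move=> /(sym_ext_neq x)[e ->].
(* The first two points exist as n is at least 2, and their nonzero coordinate provides the first
   pivot. *)
pose o : 'I_n := Ordinal (ltnW n2); pose a : 'I_n := Ordinal n2.
have [al [be [p [q [al0 xE]]]]] := gram_diagonalize (laurent_natS_neq0 1)
  (s0 o a isT) (CM_rank_defect Ix o a).
have X0 u v : u != v -> al * (p u - p v) ^+ 2 + be * (q u - q v) ^+ 2 != 0.
  by move=> uv; rewrite -xE s0.
have [D1 [D2 [c [u1 u2 valE]]]] := diagonal_form_val al0 X0.
have Nge0 : 0 <= (N%:R : RR)^-1 by rewrite invr_ge0 ler0n.
have [t1 nt1 f1] := ultrametric_tree (ultrametric_scale Nge0 u1) (ltnW n2).
have [t2 nt2 f2] := ultrametric_tree (ultrametric_scale Nge0 u2) (ltnW n2).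
exists (clade n t1 :|: clade n t2); split; first by exists t1, t2; split.
have := fan_coneD (fan_coneD f1 f2) (fan_cone_const (set0 : {set {set 'I_n}}) (- (N%:R^-1 * c))).
rewrite setU0; apply: eq_fan_cone => e.
have [r [xr ->]] := xw e.
have e12 : (val e).1 != (val e).2 by rewrite -val_eqE /= ltn_eqF // (valP e).
have := valE _ _ e12; rewrite -xE sym_ext_pair (lval_uniq xr) => ->.
by ring.
Qed.

(* The coefficient of s^m in the u-th series names the class of u for the
   equivalence relation [m < d u v]. *)
Lemma nat_ultrametric_fps n (d : 'I_n -> 'I_n -> nat) :
  (forall u v, d u v = d v u) ->
  (forall u v w, minn (d u v) (d v w) <= d u w)%N ->
  exists a : 'I_n -> fps CC, forall u v, u != v -> fps_ord (a u - a v) (d u v).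
Proof.
move=> dsym dult.
pose P m u : pred 'I_n := fun v => (v == u) || (m < d u v)%N.
(* The pick depends only on the class as a predicate, so equivalent points share it; the class
   contains [u], so the default 0 never occurs. *)
pose rep m u : nat := oapp val 0%N [pick v | P m u v].
exists (fun u => FPS (fun m => (rep m u)%:R)) => u v uv; split=> [|m muv] /=.
  rewrite subr_eq0; apply/eqP => /(natr_inj CC_natS_neq0); rewrite /rep.
  case: pickP => [r Pr|/(_ u)]; last by rewrite /P eqxx.
  case: pickP => [r' Pr' /= /val_inj E|/(_ v)]; last by rewrite /P eqxx.
  move: Pr Pr'; rewrite -E /P.
  have [->|ru] := eqVneq r u; first by rewrite (negPf uv) dsym ltnn.
  have [->|rv] := eqVneq r v => /=; first by rewrite ltnn.
  move=> ur; rewrite [d v r]dsym => rv'; have := dult u r v; lia.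
rewrite (_ : rep m u = rep m v) ?subrr // /rep; congr oapp; apply: eq_pick => r.
have step u' v' : (m < d u' v')%N -> P m u' r -> P m v' r.
  rewrite /P => uv' /predU1P[->|ur]; first by rewrite dsym uv' orbT.
  by have := dult v' u' r; rewrite [d v' u']dsym; lia.
by apply/idP/idP; apply: step; rewrite // dsym.
Qed.

Definition joint_weight (T : finType) (L : {set {set T}}) (k : {set T} -> nat) x y :=
  (\sum_(A in L | (x \in A) && (y \in A)) k A)%N.

(** If some member contains u and v but not w, then every member containing v and w contains u,
    since otherwise the two would cross at v. *)
Lemma joint_weight_ultrametric (T : finType) (L : {set {set T}}) k u v w :
  laminar L ->
  (minn (joint_weight L k u v) (joint_weight L k v w) <= joint_weight L k u w)%N.
Proof.
move=> lamL; rewrite geq_min /joint_weight.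
have sub (Q Q' : pred {set T}) : (forall A, Q A -> Q' A) ->
    (\sum_(A | Q A) k A <= \sum_(A | Q' A) k A)%N.
  move=> QQ'; rewrite big_mkcond [leqRHS]big_mkcond; apply: leq_sum => A _.
  by case: ifP => // /QQ'->.
have [H|nH] := pselect (forall A, A \in L -> u \in A -> v \in A -> w \in A).
  apply/orP; left; apply: sub => A /and3P[AL uA vA].
  by rewrite AL uA H.
apply/orP; right; apply: sub => B /and3P[BL vB wB]; rewrite BL wB andbT /=.
apply/negPn/negP => uB; apply: nH => A AL uA vA; apply/negPn/negP => wA.
exact: (laminar_cross lamL AL BL uA uB wB wA vA vB).
Qed.

Lemma laminar_fps n (L : {set {set 'I_n}}) (k : {set 'I_n} -> nat) : laminar L ->
  exists a : 'I_n -> fps CC, forall e : pair n,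
    fps_ord (a (val e).1 - a (val e).2) (\sum_(A in L | pset e \subset A) k A).
Proof.
move=> lamL.
have [||a aP] := @nat_ultrametric_fps n (joint_weight L k).
- by move=> u v; apply: eq_bigl => A; rewrite [(u \in A) && _]andbC.
- by move=> u v w; apply: joint_weight_ultrametric.
exists a => e.
have -> : (\sum_(A in L | pset e \subset A) k A)%N = joint_weight L k (val e).1 (val e).2.
  by apply: eq_bigl => A; rewrite subUset !sub1set.
by apply: aP; rewrite -val_eqE /= ltn_eqF // (valP e).
Qed.

(** The series a and b realize the weights of the two trees, so (a_u - a_v)(b_u - b_v) has the total
    as its order. The weight of [setT] may be negative; it is removed from [K] and carried by a
    scalar [s] absorbed into a. *)
Lemma TP_lattice_point n (F : {set {set 'I_n}}) (k : {set 'I_n} -> int) N :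
  (0 < N)%N -> TP_face F -> (forall A, A != setT -> 0 <= k A) ->
  (forall A, A != setT -> A \notin F -> k A = 0) ->
  trop_val_pts (CM_ideal n 2)
    (fun e => - ((\sum_(A : {set 'I_n} | pset e \subset A) k A)%:~R / N%:R)).
Proof.
move=> N0 [t1 [t2 [nt1 nt2 sF]]] k0 kF.
pose K A := if A == setT then 0%N else `|k A|%N.
have [a aP] := laminar_fps K (clade_laminar nt1).
(* Clades common to both trees are left to the first, so that no weight is counted twice. *)
have lam2 : laminar (clade n t2 :\: clade n t1).
  by move=> A B /setDP[A2 _] /setDP[B2 _]; apply: clade_laminar nt2 _ _ A2 B2.
have [b bP] := laminar_fps K lam2.
have [s s0 sE] := laurent_val_surj (k setT).
exists N, (fun e => (s * toL (a (val e).1) - s * toL (a (val e).2)) *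
                    (toL (b (val e).1) - toL (b (val e).2))); split=> //.
  by move=> f If; apply: (CM_ideal_product (fun u => s * toL (a u)) (fun u => toL (b u)) If).
move=> e; exists (\sum_(A : {set 'I_n} | pset e \subset A) k A); split=> //.
rewrite -mulrBr -!rmorphB.
have [a0 b0] := (fps_ord_neq0 (aP e), fps_ord_neq0 (bP e)).
set xa := a _ - _ in a0 *; set xb := b _ - _ in b0 *.
have [A0 B0] : toL xa != 0 /\ toL xb != 0 by rewrite !toL_eq0.
suff <- : lval (s * toL xa * toL xb) = \sum_(A : {set 'I_n} | pset e \subset A) k A.
  exact: lvalP (mulf_neq0 (mulf_neq0 s0 A0) B0).
rewrite (lvalM (mulf_neq0 s0 A0) B0) (lvalM s0 A0) sE (lval_toL (aP e)) (lval_toL (bP e)).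
rewrite [RHS](bigD1 setT) ?subsetT //= -addrA; congr (_ + _).
have sumE (L : {set {set 'I_n}}) : Posz (\sum_(A in L | pset e \subset A) K A) =
    \sum_(A : {set 'I_n} | (pset e \subset A) && (A != setT)) (if A \in L then k A else 0).
  rewrite (big_morph Posz PoszD (erefl _)) big_mkcond [RHS]big_mkcond.
  apply: eq_bigr => A _; rewrite /K.
  have [_|/k0 kA] := eqVneq A setT; first by rewrite andbF; case: ifP.
  by rewrite andbT; case: (A \in L); case: (pset e \subset A) => //=; rewrite gez0_abs.
rewrite !sumE -big_split /=; apply: eq_bigr => A /andP[_ AT]; rewrite in_setD.
case: (boolP (A \in clade n t1)) => A1; case: (boolP (A \in clade n t2)) => A2 /=;
  rewrite ?addr0 ?add0r //.
by rewrite kF //; apply/negP => /(subsetP sF); rewrite inE (negPf A1) (negPf A2).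
Qed.

Lemma TP_cone_trop n (F : {set {set 'I_n}}) w :
  TP_face F -> fan_cone (@ray n) F w -> trop (pair n) (CM_ideal n 2) w.
Proof.
move=> tF /fan_coneP[c [c0 cF wE]] eps eps0.
(* Rounding N c(A) down preserves zeros and nonnegativity and costs at most 1 / N per subset, so at
   most M / N < eps in each coordinate. *)
pose M : RR := #|{set 'I_n}|%:R.
pose N := (Num.truncn (M / eps)).+1.
have N0 : 0 < N%:R :> RR by rewrite ltr0n.
have Ni0 : 0 <= N%:R^-1 :> RR by rewrite invr_ge0 ltW.
have MN : M / N%:R < eps.
  by rewrite ltr_pdivrMr // mulrC -ltr_pdivrMr // /N truncnS_gt.
pose k A := Num.floor (N%:R * c A).
exists (fun e => - ((\sum_(A : {set 'I_n} | pset e \subset A) k A)%:~R / N%:R)); split.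
  apply: (TP_lattice_point _ tF) => // A AT.
    by rewrite /k floor_ge0 mulr_ge0 ?c0 // ltW.
  by move=> AF; rewrite /k cF // mulr0 floor0.
move=> e; rewrite wE; apply: le_lt_trans MN.
rewrite opprK addrC rmorph_sum mulr_suml -sumrB.
apply: le_trans (ler_norm_sum _ _ _) _.
apply: (@le_trans _ _ (\sum_(A : {set 'I_n}) N%:R^-1)); last first.
  by rewrite sumr_const -[leLHS]mulr_natl.
rewrite [leRHS](bigID (fun A : {set 'I_n} => pset e \subset A)) /=.
rewrite -[leLHS]addr0; apply: lerD; last first.
  by apply: sumr_ge0 => A _.
apply: ler_sum => A _; rewrite -[X in `|_ - X|](mulKf (lt0r_neq0 N0)).
rewrite [N%:R^-1 * _]mulrC -mulrBl normrM [`|N%:R^-1|]ger0_norm //.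
rewrite ler_piMl // ler_norml.
by have := floor_le (N%:R * c A); have := floorD1_gt (N%:R * c A);
  rewrite -/(k A) intrD => ? ?; apply/andP; split; lra.
Qed.

Theorem theorem3p4 (n : nat) : (2 <= n)%N ->
  exists v : {set 'I_n} -> pair n -> RR,
    is_simplicial_fan_structure_TP (trop (pair n) (CM_ideal n 2)) v.
Proof.
move=> n2; exists (@ray n); split.
- by move=> F tF lam mu; apply: TP_cones_independent.
- by move=> F G tF tG w; apply: TP_cones_inter.
move=> w; split=> [tw|[F [tF]]]; last exact: TP_cone_trop.
apply: TP_support_closed => // eps eps0.
have [w' [w'pt ww']] := tw eps eps0.
have [F [tF fw']] := trop_val_pts_cone n2 w'pt.
by exists w', F.
Qed.
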